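(* Let $\mu$ be a measure on $\mathbb{R}^{m \times n}$. (A) If $\mu$ is contracting almost everywhere and if for $\mu$-almost every $\mathbf{X}\in\mathbb{R}^{m \times n}$ we have $\omega(\mathbf{X})=v$, then for every $\boldsymbol{\theta}\in\mathbb{R}^{m}$, $\omega(\mathbf{X},\boldsymbol{\theta}) \leq v$ for $\mu$-almost every $\mathbf{X}\in\mathbb{R}^{m \times n}$. (B) If $\mu$ is strongly contracting almost everywhere and if for $\mu$-almost every $\mathbf{X}\in\mathbb{R}^{m \times n}$ we have $\omega^{\times}(\mathbf{X})=v^{\times}$, then for every $\boldsymbol{\theta}\in\mathbb{R}^{m}$, $\omega^{\times}(\mathbf{X},\boldsymbol{\theta}) \leq v^{\times}$ for $\mu$-almost every $\mathbf{X}\in\mathbb{R}^{m \times n}$.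
   Context: For $\mathbf{X}\in\mathbb{R}^{m\times n}$ and $\boldsymbol{\theta}\in\mathbb{R}^m$, $\omega(\mathbf{X},\boldsymbol{\theta})$ is the supremum of $w\geq 0$ such that for arbitrarily large $Q>1$ there is a nonzero $\mathbf{q}=(q_1,\dots,q_n)\in\mathbb{Z}^n$ with $\|\mathbf{X}\mathbf{q}+\boldsymbol{\theta}\|<Q^{-w}$ and $|\mathbf{q}|:=\max_i|q_i|\leq Q$, where $\|\cdot\|$ is the (supremum-norm) distance to the nearest integer point. The multiplicative exponent $\omega^{\times}(\mathbf{X},\boldsymbol{\theta})$ is the supremum of $w\geq0$ such that for arbitrarily large $Q>1$ there is a nonzero $\mathbf{q}\in\mathbb{Z}^n$ with $\prod_{j=1}^m |\langle \mathbf{X}\mathbf{q}+\boldsymbol{\theta}\rangle_j| < Q^{-mw}$ and $\prod_{i=1}^n\max\{1,|q_i|\}\leq Q^n$, where $\langle\mathbf{y}\rangle$ is the unique point of $[-1/2,1/2)^m$ congruent to $\mathbf{y}$ modulo $\mathbb{Z}^m$. The homogeneous exponents are $\omega(\mathbf{X})=\omega(\mathbf{X},\mathbf{0})$ and $\omega^{\times}(\mathbf{X})=\omega^{\times}(\mathbf{X},\mathbf{0})$. A measure $\mu$ on $\mathbb{R}^{m\times n}$ with support $S$ is doubling if there is $\lambda>1$ with $\mu(2B)\leq\lambda\mu(B)$ for every ball $B$ centred in $S$ (where $cB$ is the ball with the same centre and $c$ times the radius). For $\mathbf{a}\in\mathbb{R}^n$ with $\|\mathbf{a}\|_2=1$ and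 $\mathbf{b}=(b_1,\dots,b_m)\in\mathbb{R}^m$, let $\mathcal{L}_{\mathbf{a},\mathbf{b}}=\{\mathbf{X}:\mathbf{X}\mathbf{a}+\mathbf{b}=0\}$ and, for $\boldsymbol{\varepsilon}=(\varepsilon_1,\dots,\varepsilon_m)\in(0,\infty)^m$, $\mathcal{L}^{\boldsymbol{\varepsilon}}_{\mathbf{a},\mathbf{b}}=\{\mathbf{X}: |\mathbf{X}_j\mathbf{a}+b_j|<\varepsilon_j \text{ for all } 1\leq j\leq m\}$, where $\mathbf{X}_j$ is the $j$-th row of $\mathbf{X}$. A non-atomic, finite, doubling Borel measure $\mu$ is strongly contracting if there are constants $C,\alpha,r_0>0$ such that for every such plane, every $\boldsymbol{\varepsilon}$ with $\min_j\varepsilon_j<r_0$ and every $\delta\in(0,1)$: for all $\mathbf{X}\in\mathcal{L}^{\delta\boldsymbol{\varepsilon}}_{\mathbf{a},\mathbf{b}}\cap S$ there is an open ball $B$ centred at $\mathbf{X}$ with $B\cap S\subset\mathcal{L}^{\boldsymbol{\varepsilon}}_{\mathbf{a},\mathbf{b}}$ and $\mu(5B\cap\mathcal{L}^{\delta\boldsymbol{\varepsilon}}_{\mathbf{a},\mathbf{b}})\leq C\delta^{\alpha}\mu(5B)$. It is contracting if this holds with $\varepsilon_1=\dots=\varepsilon_m$. It is (strongly) contracting almost everywhere if for $\mu$-almost every $\mathbf{X}_0$ there is a neighbourhood $U$ of $\mathbf{X}_0$ such that $\mu|_U$ is (strongly) contracting. *)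

(* Defs.v *)
From mathcomp Require Import all_boot all_order all_algebra.
From mathcomp Require Import lra.
From mathcomp Require Import all_classical all_reals all_analysis.

Set Implicit Arguments.
Unset Strict Implicit.
Unset Printing Implicit Defensive.

Import Order.TTheory GRing.Theory Num.Theory.
Import numFieldNormedType.Exports.

Local Open Scope classical_set_scope.
Local Open Scope ring_scope.

(* R^(m x n) with its Borel sigma-algebra. On the underlying matrix type, [ball]
   and [`| |] are those of the supremum norm. *)
Notation borel_mx R m n := (g_sigma_algebraType (@open 'M[R]_(m, n))).

Section exponents.
Context {R : realType}.

Definition int_vec n (q : 'cV[int]_n) : 'cV[R]_n := map_mx intr q.

Definition dist_int m (y : 'cV[R]_m) : R :=
  inf [set `|y - int_vec p| | p in [set: 'cV[int]_m]].

Definition centred m (y : 'cV[R]_m) : 'cV[R]_m :=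
  \col_j (y j 0 - (Num.floor (y j 0 + 2^-1))%:~R).

Lemma centredP m (y z : 'cV[R]_m) :
  z = centred y <->
  (forall j, - 2^-1 <= z j 0 < 2^-1) /\ (exists p, y - z = int_vec p).
Proof.
split=> [->|[zb [p yz]]].
  split=> [j|].
    rewrite mxE; have /andP[] := Num.Theory.floor_itv (y j 0 + 2^-1).
    rewrite intrD; set f := (Num.floor _)%:~R; move=> ? ?; apply/andP; split; lra.
  exists (\col_j Num.floor (y j 0 + 2^-1)); apply/matrixP => j k.
  by rewrite !mxE (ord1 k) opprB addrC subrK.
apply/matrixP => j k; rewrite mxE (ord1 k).
have /matrixP/(_ j 0) := yz; rewrite !mxE => yzj.
suff -> : Num.floor (y j 0 + 2^-1) = p j 0 by rewrite -yzj opprB addrC subrK.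
apply: Num.Theory.floor_def; rewrite intrD -yzj.
by move/andP: (zb j) => [? ?]; apply/andP; split; lra.
Qed.

Definition dioph_exp m n (X : 'M[R]_(m, n)) (theta : 'cV[R]_m) : \bar R :=
  ereal_sup [set w%:E | w in [set w : R | 0 <= w /\
    forall Q0 : R, exists Q : R, [/\ Q0 <= Q, 1 < Q &
      exists q : 'cV[int]_n, [/\ q != 0,
        dist_int (X *m int_vec q + theta) < Q `^ (- w) &
        (\max_(i < n) `|(q i 0)%R|%N)%:R <= Q]]]].

Definition dioph_mexp m n (X : 'M[R]_(m, n)) (theta : 'cV[R]_m) : \bar R :=
  ereal_sup [set w%:E | w in [set w : R | 0 <= w /\
    forall Q0 : R, exists Q : R, [/\ Q0 <= Q, 1 < Q &
      exists q : 'cV[int]_n, [/\ q != 0,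
        \prod_(j < m) `|centred (X *m int_vec q + theta) j 0|
          < Q `^ (- (m%:R * w)) &
        (\prod_(i < n) maxn 1 `|(q i 0)%R|%N)%:R <= Q ^+ n]]]].

End exponents.

Section contracting.
Context {R : realType} {m n : nat}.
Implicit Types mu : {measure set (borel_mx R m n) -> \bar R}.
Local Open Scope ereal_scope.

Definition msupport mu : set 'M[R]_(m, n) :=
  [set X | forall U : set 'M[R]_(m, n), open_nbhs X U -> 0 < mu U].

Definition non_atomic mu : Prop :=
  forall A : set (borel_mx R m n), measurable A -> 0 < mu A ->
    exists B : set (borel_mx R m n),
      [/\ measurable B, B `<=` A, 0 < mu B & mu B < mu A].

Definition doubling mu : Prop :=
  exists2 lambda : R, (1 < lambda)%R &
    forall (X : 'M[R]_(m, n)) (r : R), msupport mu X -> (0 < r)%R ->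
      mu (ball X (2 * r)%R) <= lambda%:E * mu (ball X r).

Definition slab (a : 'cV[R]_n) (b eps : 'cV[R]_m) : set 'M[R]_(m, n) :=
  [set X | forall j, (`|(X *m a + b) j 0| < eps j 0)%R].

(* The set [E] is the family of admissible eps: all of them for the strong
   notion, those with equal coordinates for the plain one. *)
Definition contracting_on (E : set 'cV[R]_m) mu : Prop :=
  [/\ non_atomic mu, mu setT < +oo, doubling mu &
  exists C alpha r0 : R, [/\ (0 < C)%R, (0 < alpha)%R, (0 < r0)%R &
    forall (a : 'cV[R]_n) (b eps : 'cV[R]_m) (delta : R),
      (\sum_(i < n) a i 0 ^+ 2 = 1)%R ->
      E eps -> (forall j, (0 < eps j 0)%R) ->
      \big[mine/+oo]_(j < m) (eps j 0)%:E < r0%:E ->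
      (0 < delta < 1)%R ->
      forall X : 'M[R]_(m, n),
        slab a b (delta *: eps)%R X -> msupport mu X ->
        exists2 r : R, (0 < r)%R &
          ball X r `&` msupport mu `<=` slab a b eps /\
          mu (ball X (5 * r)%R `&` slab a b (delta *: eps)%R)
            <= (C * delta `^ alpha)%:E * mu (ball X (5 * r)%R)]].

Definition strongly_contracting mu : Prop := contracting_on setT mu.

Definition contracting mu : Prop :=
  contracting_on [set eps : 'cV[R]_m | forall j k, eps j 0%R = eps k 0%R] mu.

Definition locally_ae
    (P : {measure set (borel_mx R m n) -> \bar R} -> Prop) mu : Prop :=
  {ae mu, forall X0 : borel_mx R m n,
    exists (U : set (borel_mx R m n)) (mU : measurable U),
      nbhs (X0 : 'M[R]_(m, n)) U /\ P (mrestr mu mU)}.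

End contracting.

(* Main.v *)
Require Import Defs.
From mathcomp Require Import all_boot all_order all_algebra.
From mathcomp Require Import ring lra zify.
From mathcomp Require Import all_classical all_reals all_analysis.

(** Let w1 < w2 be exponents above the generic homogeneous one. The points where
    [theta] is approximated with exponent w2 lie in infinitely many thin slabs
    |X q + theta - p|_j < 2^-t eps_j of level t. If the thick slabs of half-widths
    eps_j of two distinct (q, p), (q', p') of the same level meet at X, subtracting
    gives a homogeneous approximation of X by q - q' with exponent w1, so almost
    every X lies in only finitely many such overlaps; let G be the union of the
    overlaps of level at least N, which has small measure for N large.
    Contraction attaches to each X of the support in a thin slab a ball B lying
    (within the support) in the thick slab, such that the thin slab has proportion
    O(2^-(alpha t)) in 5B. If G takes less than half of the mass of B, then B
    is charged to the part of the thick slab outside G; these parts are disjoint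
    at each level, so such X have measure O(2^-(alpha t)) at level t, which is
    summable. Otherwise the maximal function of the indicator of G is at least 1/2
    at X, and the weak-type inequality for doubling measures makes the set of such
    X small.
    In the multiplicative case the slabs of level t are first sorted into boundedly
    many classes, according to the size of each |X q + theta - p|_j and each |q_i|
    in the scale of powers of 2^t, and the argument is run in each class. *)

Set Implicit Arguments.
Unset Strict Implicit.
Unset Printing Implicit Defensive.

Import Order.TTheory GRing.Theory Num.Theory.
Import numFieldNormedType.Exports.

Local Open Scope classical_set_scope.
Local Open Scope ring_scope.

(** * Countable covers by balls *)

(** Balls with rational centres and radii [1/(j+1)] form a countable base. For each one inside some
    [ball X (r X)] with [A X], one such [X] is kept. This suffices, as each [X] of [A] lies in a
    basic ball inside [ball X (r X)]. *)
Lemma mx_lindelof (R : realType) m n (A : set 'M[R]_(m, n))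
    (r : 'M[R]_(m, n) -> R) :
  A !=set0 -> (forall X, A X -> 0 < r X) ->
  exists2 f : nat -> 'M[R]_(m, n), forall k, A (f k) &
    A `<=` \bigcup_k ball (f k) (r (f k)).
Proof.
move=> [X0 AX0] r_gt0.
pose O (k : nat) : set 'M[R]_(m, n) :=
  if unpickle k is Some (Y, j)
  then ball (map_mx ratr (Y : 'M[rat]_(m, n)) : 'M[R]_(m, n)) (j.+1%:R^-1)
  else set0.
have [f fP] : {f : nat -> 'M[R]_(m, n) & forall k, A (f k) /\
    ((exists2 X, A X & O k `<=` ball X (r X)) ->
     O k `<=` ball (f k) (r (f k)))}.
  apply: (@choice _ _ (fun k Y => A Y /\ ((exists2 X, A X &
    O k `<=` ball X (r X)) -> O k `<=` ball Y (r Y)))) => k.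
  have [[X AX OX]|no] := pselect (exists2 X, A X & O k `<=` ball X (r X)).
    by exists X.
  by exists X0.
exists f => [k|X AX]; first by have [] := fP k.
have rX := r_gt0 _ AX.
have [j jr] : exists j : nat, j.+1%:R^-1 < r X / 2.
  have := @ltr_add_invr R 0 (r X / 2) (divr_gt0 rX (ltr0n _ 2)).
  by move=> [k]; rewrite add0r; exists k.
have j0 : 0 < j.+1%:R^-1 :> R by rewrite invr_gt0.
have [Y XY] : {Y : 'I_m * 'I_n -> rat & forall ij,
    ratr (Y ij) \in `](X ij.1 ij.2 - j.+1%:R^-1), (X ij.1 ij.2 + j.+1%:R^-1)[}.
  apply: (@choice _ _ (fun ij y =>
    ratr y \in `](X ij.1 ij.2 - j.+1%:R^-1), (X ij.1 ij.2 + j.+1%:R^-1)[)).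
  by move=> ij; apply: rat_in_itvoo; rewrite ltrBlDr -addrA ltrDl addr_gt0.
pose Y' : 'M[rat]_(m, n) := \matrix_(i, k) Y (i, k).
have OkX : O (pickle (Y', j)) X.
  rewrite /O pickleK; split => // i k.
  rewrite /= /ball /= !mxE; have := XY (i, k).
  by rewrite in_itv/= ltr_norml; set e := _^-1 => /andP[? ?]; lra.
exists (pickle (Y', j)) => //.
have [_] := fP (pickle (Y', j)); apply => //.
exists X => //; move: OkX; rewrite /O pickleK => YX Z YZ.
apply: (@le_ball _ _ _ (j.+1%:R^-1 + j.+1%:R^-1)).
  by move: jr; set e := _^-1; lra.
by apply: ball_triangle YZ; exact: ball_sym.
Qed.

(** * Borel measures on matrix spaces *)

Section measure_mx.
Context {R : realType} {m n : nat}.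
Implicit Types nu : {measure set (borel_mx R m n) -> \bar R}.
Local Notation M := 'M[R]_(m, n).

Lemma open_borel_mx (A : set M) :
  open A -> measurable (A : set (borel_mx R m n)).
Proof. by move=> oA; exact: sub_sigma_algebra. Qed.

Lemma ball_borel_mx (X : M) r :
  measurable (ball X r : set (borel_mx R m n)).
Proof. by apply: open_borel_mx; exact: ball_open. Qed.

Lemma negligible_locally nu (A : set M) :
  (forall X, A X -> exists2 r : R, 0 < r & nu.-negligible (A `&` ball X r)) ->
  nu.-negligible A.
Proof.
move=> loc; have [->|/set0P A0] := eqVneq A set0; first exact: negligible_set0.
have [r rP] : {r : M -> R & forall X, A X ->
    0 < r X /\ nu.-negligible (A `&` ball X (r X))}.
  apply: (@choice _ _ (fun X r => A X ->
    0 < r /\ nu.-negligible (A `&` ball X r))) => X.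
  have [/loc[r r0 nr]|nA] := pselect (A X); first by exists r.
  by exists 0.
have [|f fA Af] := @mx_lindelof _ _ _ A r A0; first by move=> X /rP[].
suff: nu.-negligible (\bigcup_k (A `&` ball (f k) (r (f k)))).
  by apply: negligibleS => X AX; have [k _ kX] := Af _ AX; exists k.
by apply: negligible_bigcup => k; have [] := rP _ (fA k).
Qed.

(** Each point outside the support has a null ball around it, and countably many of these balls
    cover the complement. *)
Lemma msupport_full nu : nu.-negligible (~` msupport nu).
Proof.
apply: negligible_locally => X /existsNP[U /not_implyP[[oU UX]]].
move/negP; rewrite -leNgt => U0.
have /nbhs_ballP[r /= r0 rU] := open_nbhs_nbhs (conj oU UX).
exists r => //; exists (ball X r); split; last exact: subIsetr.
  exact: ball_borel_mx.
apply/eqP; rewrite eq_le measure_ge0 andbT (le_trans _ U0)//.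
by apply: le_measure => //; rewrite inE; [exact: ball_borel_mx|
  exact: open_borel_mx].
Qed.

Lemma maximal_radius (r : M -> R) (s : seq M) : s != [::] ->
  exists2 x, x \in s & forall y, y \in s -> r y <= r x.
Proof.
elim: s => // x s IH _; have [->|/IH[y ys ymax]] := eqVneq s [::].
  by exists x => [|y]; rewrite mem_seq1// => /eqP ->.
have [xy|yx] := leP (r x) (r y).
  exists y => [|z]; first by rewrite inE ys orbT.
  by rewrite inE => /predU1P[->//|/ymax].
exists x => [|z]; first by rewrite inE eqxx.
by rewrite inE => /predU1P[->//|/ymax zy]; rewrite (le_trans zy)// ltW.
Qed.

(** Greedy Vitali selection: take a ball of largest radius, absorb the balls meeting it into its
    fivefold dilate, and recurse on those disjoint from it. The selected balls are disjoint, so the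
    bounds by [H] add up. *)
Lemma vitali_measure_seq nu (r : M -> R) (Z H : set M) (K : R) (s : seq M) :
  measurable (Z : set (borel_mx R m n)) ->
  measurable (H : set (borel_mx R m n)) -> 0 <= K ->
  (forall X, X \in s -> 0 < r X /\
    (nu (ball X (5 * r X)%R `&` Z) <= K%:E * nu (ball X (r X) `&` H))%E) ->
  (nu (Z `&` \big[setU/set0]_(X <- s) ball X (r X)) <=
   K%:E * nu (H `&` \big[setU/set0]_(X <- s) ball X (r X)))%E.
Proof.
move=> mZ mH K0; have [k] := ubnP (size s).
elim: k s => // k IH s; rewrite ltnS => sk sP.
have mU t : measurable (\big[setU/set0]_(X <- t) ball X (r X)
    : set (borel_mx R m n)).
  by apply: bigsetU_measurable => i _; exact: ball_borel_mx.
have [->|s0] := eqVneq s [::].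
  by rewrite big_nil !setI0 !measure0 mule0.
have [x xs xmax] := maximal_radius r s0.
have [rx xP] := sP _ xs.
pose p y := `[< ball x (r x) `&` ball y (r y) = set0 >].
pose s' := [seq y <- s | p y].
have s's y : y \in s' -> y \in s by rewrite mem_filter => /andP[].
have xs' : ~~ p x.
  apply/asboolP => /seteqP[+ _] => /(_ x); apply; split; exact: ballxx.
have szs' : (size s' < k)%N.
  rewrite (leq_trans _ sk)// size_filter -(count_predC p s) -[ltnLHS]addn0.
  by rewrite ltn_add2l -has_count; apply/hasP; exists x.
have {}IH := IH _ szs' (fun y ys => sP y (s's y ys)).
set U' := \big[setU/set0]_(X <- s') _ in IH.
have mU' : measurable (U' : set (borel_mx R m n)) by exact: mU.
have mx q := ball_borel_mx x q.
have dU' : ball x (r x) `&` U' = set0.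
  apply/seteqP; split => // z [xz]; rewrite /U' -bigcup_seq.
  move=> [y /=]; rewrite mem_filter => /andP[/asboolP/seteqP[+ _] _] yz.
  by move=> /(_ z); apply.
apply: (@le_trans _ _ (nu (ball x (5 * r x)%R `&` Z) + nu (Z `&` U'))%E).
  apply: le_trans (measureU2 _ _ _); last 2 first.
  - exact: measurableI.
  - exact: measurableI.
  apply: le_measure; rewrite ?inE; first exact: measurableI.
    by apply: measurableU; exact: measurableI.
  move=> z [Zz]; rewrite -bigcup_seq => -[y /= ys yz].
  have [py|npy] := boolP (p y).
    right; split => //; rewrite /U' -bigcup_seq; exists y => //=.
    by rewrite mem_filter py.
  left; split=> //; move/asboolP/eqP/set0P : npy => [w [xw yw]].
  (* As [r y <= r x], a ball meeting [ball x (r x)] reaches at most [3 * r x] from [x]. *)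
  apply: (@le_ball _ _ _ (r x + r y + r y)); first by have := xmax _ ys; lra.
  by apply: ball_triangle yz; apply: ball_triangle xw _; exact: ball_sym.
apply: (le_trans (leeD xP IH)).
rewrite -muleDr//; last by rewrite ge0_adde_def// inE measure_ge0.
apply: lee_wpmul2l; first by rewrite lee_fin.
rewrite -measureU; [|exact: measurableI|exact: measurableI|].
  apply: le_measure; rewrite ?inE; first by apply: measurableU; exact: measurableI.
    exact: measurableI.
  move=> z [[xz Hz]|[Hz]]; [split=> //|rewrite /U']; rewrite -!bigcup_seq.
    by exists x.
  by move=> [y /= /s's ys yz]; split => //; exists y.
by rewrite (setIC H) setIACA dU' set0I.
Qed.

(* Passing to a countable subcover first and taking the limit over its finite
   subfamilies avoids any bound on the radii. *)
Lemma vitali_measure nu (A : set M) (r : M -> R) (Z H : set M) (K : R) :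
  measurable (Z : set (borel_mx R m n)) ->
  measurable (H : set (borel_mx R m n)) -> 0 <= K ->
  (forall X, A X -> 0 < r X /\
    (nu (ball X (5 * r X)%R `&` Z) <= K%:E * nu (ball X (r X) `&` H))%E) ->
  exists W : set (borel_mx R m n),
    [/\ measurable W, A `&` Z `<=` W & (nu W <= K%:E * nu H)%E].
Proof.
move=> mZ mH K0 AP; have [->|/set0P A0] := eqVneq A set0.
  by exists set0; split; rewrite ?set0I// measure0 mule_ge0// lee_fin.
have [|f fA Af] := @mx_lindelof _ _ _ A r A0; first by move=> X /AP[].
pose F k : set (borel_mx R m n) :=
  Z `&` \big[setU/set0]_(X <- [seq f i | i <- iota 0 k]) ball X (r X).
have mF k : measurable (F k).
  apply: measurableI => //; apply: bigsetU_measurable => i _.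
  exact: ball_borel_mx.
have mUF : measurable (\bigcup_k F k) by exact: bigcupT_measurable.
exists (\bigcup_k F k); split => //.
  move=> X [AX ZX]; have [k _ kX] := Af _ AX; exists k.+1 => //; split => //.
  have fk : f k \in [seq f i | i <- iota 0 k.+1].
    by apply: map_f; rewrite mem_iota add0n leqnn.
  by rewrite -bigcup_seq; exists (f k).
have ndF : {homo F : n m / (n <= m)%N >-> (n <= m)%O}.
  move=> i j ij; apply/subsetPset => X [ZX]; rewrite -bigcup_seq.
  move=> [_ /= /mapP[k + ->] kX]; rewrite mem_iota add0n => /= ki; split => //.
  have fk : f k \in [seq f i | i <- iota 0 j].
    by apply: map_f; rewrite mem_iota add0n (leq_trans ki).
  by rewrite -bigcup_seq; exists (f k).
have cF : (nu \o F) k @[k --> \oo] --> nu (\bigcup_k F k).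
  exact: nondecreasing_cvg_mu.
rewrite -(cvg_lim _ cF)//; apply: lime_le; first exact: (cvgP _ cF).
apply: nearW => k /=; rewrite /F.
apply: le_trans (@vitali_measure_seq nu r Z H K _ mZ mH K0 _) _.
  by move=> X /mapP[i _ ->]; exact: AP.
apply: lee_wpmul2l; first by rewrite lee_fin.
apply: le_measure; rewrite ?inE//.
apply: measurableI => //; apply: bigsetU_measurable => i _.
exact: ball_borel_mx.
Qed.

Lemma negligible_small_covers nu (A : set M) :
  (forall e : R, 0 < e -> exists W : set (borel_mx R m n),
    [/\ measurable W, A `<=` W & (nu W <= e%:E)%E]) -> nu.-negligible A.
Proof.
move=> small.
have [W WP] : {W : nat -> set (borel_mx R m n) & forall k,
    [/\ measurable (W k), A `<=` W k & (nu (W k) <= (k.+1%:R^-1)%:E)%E]}.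
  by apply: (@choice _ _ (fun k (W : set (borel_mx R m n)) => [/\ measurable W, A `<=` W &
    (nu W <= (k.+1%:R^-1)%:E)%E])) => k; apply: small; rewrite invr_gt0.
have mW : measurable (\bigcap_k W k).
  by apply: bigcapT_measurable => k; have [] := WP k.
exists (\bigcap_k W k); split => //; last first.
  by move=> X AX k _; have [_ AW _] := WP k; exact: AW.
apply/eqP; rewrite eq_le measure_ge0 andbT; apply/lee_addgt0Pr => e e0.
rewrite add0e; have [k ke] := ltr_add_invr e0.
have [mWk _ Wk] := WP k; apply: (@le_trans _ _ (nu (W k))).
  by apply: le_measure; rewrite ?inE// => X; apply.
by rewrite (le_trans Wk)// lee_fin ltW// -[ltLHS]add0r.
Qed.

End measure_mx.

(** * Transference between thin and thick families *)

Section transference.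
Context {R : realType} {m n : nat}.
Variable nu : {measure set (borel_mx R m n) -> \bar R}.
Local Notation M := 'M[R]_(m, n).
Local Notation S := (msupport nu).
Hypothesis nu_fin : (nu setT < +oo)%E.
Variable lam : R.
Hypothesis lam_gt1 : 1 < lam.
Hypothesis nuD : forall (X : M) (r : R), S X -> 0 < r ->
  (nu (ball X (2 * r)%R) <= lam%:E * nu (ball X r))%E.

(** Three doublings suffice, since [5 <= 2^3]. *)
Lemma doubling5 (X : M) (r : R) : S X -> 0 < r ->
  (nu (ball X (5 * r)%R) <= (lam ^+ 3)%:E * nu (ball X r))%E.
Proof.
move=> SX r0; have l0 : (0 <= lam%:E)%E by rewrite lee_fin; move: lam_gt1; lra.
apply: (@le_trans _ _ (nu (ball X (2 * (2 * (2 * r)))))).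
  apply: le_measure; rewrite ?inE; try exact: ball_borel_mx.
  by apply: le_ball; lra.
rewrite exprS exprS expr1 !EFinM -!muleA.
apply: le_trans (nuD SX _) _; first lra.
apply: lee_wpmul2l => //; apply: le_trans (nuD SX _) _; first lra.
by apply: lee_wpmul2l => //; exact: nuD.
Qed.

(** [L t i] and [Z t i] stand for the thick and thin slabs of level [t], and [c t] for the
    proportion granted by contraction. *)
Variables (L Z : nat -> nat -> set M) (c : nat -> R).
Hypothesis mL : forall t i, measurable (L t i : set (borel_mx R m n)).
Hypothesis mZ : forall t i, measurable (Z t i : set (borel_mx R m n)).
Hypothesis c_ge0 : forall t, 0 <= c t.
Hypothesis c_sum : (\sum_(0 <= t <oo) (c t)%:E < +oo)%E.
Variable t0 : nat.
Hypothesis contr : forall t i (X : M), (t0 <= t)%N -> Z t i X -> S X ->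
  exists2 r : R, 0 < r & ball X r `&` S `<=` L t i /\
    (nu (ball X (5 * r)%R `&` Z t i) <= (c t)%:E * nu (ball X (5 * r)%R))%E.

Let D t : set (borel_mx R m n) :=
  \bigcup_i \bigcup_(j in [set j | j != i]) (L t i `&` L t j).
Let G N : set (borel_mx R m n) := \bigcup_t D (N + t)%N.

Let mD t : measurable (D t).
Proof.
apply: bigcupT_measurable => i; apply: bigcup_measurable => j _.
exact: measurableI.
Qed.

Let mG N : measurable (G N).
Proof. by apply: bigcupT_measurable. Qed.

Let fin_nu (A : set (borel_mx R m n)) : measurable A -> nu A \is a fin_num.
Proof.
move=> mA; rewrite ge0_fin_numE//; apply: le_lt_trans nu_fin.
by apply: le_measure; rewrite ?inE//.
Qed.

(** Contraction locates a ball only within the support; as the complement is null, such an inclusion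
    still compares measures. *)
Let nu_outside (U V : set M) :
  measurable (U : set (borel_mx R m n)) ->
  measurable (V : set (borel_mx R m n)) ->
  U `&` S `<=` V -> (nu U <= nu V)%E.
Proof.
move=> mU mV USV; have [B [mB B0 SB]] := msupport_full nu.
have mVB := measurableU _ _ mV mB.
apply: (@le_trans _ _ (nu (V `|` B))).
  apply: le_measure; rewrite ?inE// => X UX.
  have [SX|nSX] := pselect (S X); first by left; apply: USV.
  by right; apply: SB.
by rewrite (le_trans (measureU2 _ _ _))// [X in (_ + X)%E]B0 adde0.
Qed.

(** For the ball [B] given by contraction, the thin set has mass at most
    [c t * nu (5B) <= c t * lam^3 * nu B] in [5B], and [nu B] is less than twice the mass of [B]
    outside [G N], which lies in [L t i] up to a null set. So [vitali_measure] applies. *)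
Let covers_essential N t i : (t0 <= t)%N -> (N <= t)%N ->
  exists W : set (borel_mx R m n), [/\ measurable W,
    [set X | [/\ Z t i X, S X & forall r : R, 0 < r ->
      (2%:E * nu (ball X r `&` G N) < nu (ball X r))%E]] `<=` W &
    (nu W <= (2 * lam ^+ 3 * c t)%:E * nu (L t i `\` G N))%E].
Proof.
move=> tt0 Nt.
set A := [set X | _].
have [r rP] : {r : M -> R & forall X, A X -> 0 < r X /\
    (ball X (r X) `&` S `<=` L t i /\
    (nu (ball X (5 * r X)%R `&` Z t i)
      <= (c t)%:E * nu (ball X (5 * r X)%R))%E)}.
  apply: (@choice _ _ (fun (X : M) r => A X -> 0 < r /\
    (ball X r `&` S `<=` L t i /\
    (nu (ball X (5 * r)%R `&` Z t i) <= (c t)%:E * nu (ball X (5 * r)%R))%E))).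
  move=> X; have [[ZX SX ess]|nA] := pselect (A X); last by exists 0.
  by have [r r0 ?] := contr tt0 ZX SX; exists r.
have l0 : 0 <= lam ^+ 3 by rewrite exprn_ge0//; move: lam_gt1; lra.
have mH : measurable (L t i `\` G N : set (borel_mx R m n)).
  by apply: measurableD.
have [||||W [mW AW WH]] := @vitali_measure _ _ _ nu A r (Z t i)
    (L t i `\` G N) (2 * lam ^+ 3 * c t) => //.
- by apply: mulr_ge0 => //; apply: mulr_ge0.
- move=> X AX; have [rX [BL nuB]] := rP _ AX; have [ZX SX ess] := AX.
  split => //; apply: le_trans nuB _.
  rewrite (mulrC _ (c t)) EFinM -muleA.
  apply: lee_wpmul2l; first by rewrite lee_fin.
  apply: le_trans (doubling5 SX rX) _; rewrite (mulrC 2) [(lam ^+ 3 * 2)%:E]EFinM -muleA.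
  apply: lee_wpmul2l; first by rewrite lee_fin.
  have mB := ball_borel_mx X (r X).
  have := ess _ rX; set B := ball X (r X).
  have -> : nu B = (nu (B `&` G N) + nu (B `\` G N))%E.
    by rewrite (measureDI _ mB (mG N)) addeC.
  have : (nu (B `\` G N) <= nu (B `&` (L t i `\` G N)))%E.
    apply: nu_outside => //; [exact: measurableD|exact: measurableI|].
    by move=> Y [[BY nGY] SY]; split => //; split => //; apply: BL.
  have fI : nu (B `&` G N) \is a fin_num by apply/fin_nu/measurableI.
  have fD : nu (B `\` G N) \is a fin_num by apply/fin_nu/measurableD.
  have fH : nu (B `&` (L t i `\` G N)) \is a fin_num.
    by apply/fin_nu/measurableI.
  rewrite -(fineK fI) -(fineK fD) -(fineK fH) -!EFinD -!EFinM.
  by rewrite lte_fin !lee_fin; lra.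
by exists W; split => //; move=> X AX; apply: AW; split => //; case: AX.
Qed.

(** The weak-type estimate for the maximal function of the indicator of [G N]: [vitali_measure] with
    the whole space as [Z] and [G N] as [H]. *)
Let covers_inessential N :
  exists W : set (borel_mx R m n), [/\ measurable W,
    [set X | S X /\ exists2 r : R, 0 < r &
      (nu (ball X r) <= 2%:E * nu (ball X r `&` G N))%E] `<=` W &
    (nu W <= (2 * lam ^+ 3)%:E * nu (G N))%E].
Proof.
set A := [set X | _].
have [r rP] : {r : M -> R & forall X, A X -> 0 < r X /\
    (nu (ball X (r X)) <= 2%:E * nu (ball X (r X) `&` G N))%E}.
  apply: (@choice _ _ (fun (X : M) r => A X -> 0 < r /\
    (nu (ball X r) <= 2%:E * nu (ball X r `&` G N))%E)).
  move=> X; have [[_ [r r0 ?]]|nA] := pselect (A X); last by exists 0.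
  by exists r.
have l0 : 0 <= lam ^+ 3 by rewrite exprn_ge0//; move: lam_gt1; lra.
have [||||W [mW AW WH]] := @vitali_measure _ _ _ nu A r setT
    (G N) (2 * lam ^+ 3) => //.
- by apply: mulr_ge0.
- move=> X AX; have [rX nuB] := rP _ AX; split => //; rewrite setIT.
  apply: le_trans (doubling5 AX.1 rX) _; rewrite (mulrC 2) [(lam ^+ 3 * 2)%:E]EFinM -muleA.
  by apply: lee_wpmul2l; rewrite ?lee_fin.
by exists W; split => //; move=> X AX; apply: AW; split.
Qed.

Hypothesis overlap : nu.-negligible [set X : M |
  forall N, exists2 t, (N <= t)%N & exists i j, [/\ i != j, L t i X & L t j X]].

(** Continuity from above: the sets [G N] decrease, and their intersection lies in the null set of
    [overlap]. *)
Let nuG0 (e : R) : 0 < e -> exists2 N, (t0 <= N)%N & (nu (G N) <= e%:E)%E.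
Proof.
move=> e0.
have mI : measurable (\bigcap_N G N) by apply: bigcapT_measurable.
have nuI : nu (\bigcap_N G N) = 0%E.
  apply/(negligibleP _ mI); apply: negligibleS overlap => X GX N.
  have [t _ [i _ [j /= ij [Xi Xj]]]] := GX N I.
  by exists (N + t)%N; [exact: leq_addr|exists i, j; rewrite eq_sym].
have cG : (nu \o G) k @[k --> \oo] --> nu (\bigcap_N G N).
  apply: nonincreasing_cvg_mu => //.
    by apply: le_lt_trans nu_fin; apply: le_measure; rewrite ?inE.
  move=> a b ab; apply/subsetPset => X [t _ Dt].
  by exists (b - a + t)%N => //; rewrite addnA subnKC.
move: cG; rewrite nuI => /fine_cvgP[_ /cvgrPdist_le/(_ _ e0)].
move=> [N1 _ N1P]; exists (maxn N1 t0); first exact: leq_maxr.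
have := N1P (maxn N1 t0) (leq_maxl _ _).
rewrite /= sub0r normrN ger0_norm ?fine_ge0// => h.
by rewrite -(fineK (fin_nu (mG _))) lee_fin.
Qed.

Lemma inhomogeneous_transference : nu.-negligible [set X : M |
  forall N, exists2 t, (N <= t)%N & exists i, Z t i X].
Proof.
set A := [set X | _].
suff : nu.-negligible (A `&` S).
  move=> nAS; have := negligibleU nAS (msupport_full nu).
  apply: negligibleS => X AX.
  by have [SX|nSX] := pselect (S X); [left|right].
apply: negligible_small_covers => e e0.
have l1 : 1 <= lam ^+ 3 by rewrite exprn_ege1// ltW.
have l0 : 0 < 2 * lam ^+ 3 by lra.
(* Half of [e] pays for the points with an inessential ball, the other half for the levels from [T]
   on. *)
have [N Nt0 GN] := @nuG0 (e / 2 / (2 * lam ^+ 3))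
  (divr_gt0 (divr_gt0 e0 (ltr0n _ 2)) l0).
have [W0 [mW0 AW0 nuW0]] := covers_inessential N.
(* The summand 1 keeps [K] positive even when [nu] vanishes. *)
set K := 2 * lam ^+ 3 * (fine (nu setT) + 1).
have f0 : 0 <= fine (nu setT) by rewrite fine_ge0.
have K0 : 0 < K by rewrite mulr_gt0//; lra.
have [T NT cT] : exists2 T, (N <= T)%N &
    (\sum_(T <= t <oo) (c t)%:E <= (e / 2 / K)%:E)%E.
  have ce0 : 0 < e / 2 / K by rewrite !divr_gt0.
  have cE t : xpredT t -> (0 <= (c t)%:E)%E by rewrite lee_fin.
  have := nneseries_tail_cvg c_sum cE.
  move=> /fine_cvgP[[N1 _ N1P] /cvgrPdist_le/(_ _ ce0)[N2 _ N2P]].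
  exists (maxn N (maxn N1 N2)); first exact: leq_maxl.
  have h1 := N1P (maxn N (maxn N1 N2)).
  have h2 := N2P (maxn N (maxn N1 N2)).
  rewrite -(fineK (h1 _)); last by rewrite /= !leq_max leqnn orbT.
  move: h2; rewrite /= sub0r normrN ger0_norm; last first.
    by apply: fine_ge0; apply: nneseries_ge0 => *; exact: cE.
  by move=> h2; rewrite lee_fin h2// !leq_max leqnn !orbT.
have [W WP] : {W : nat * nat -> set (borel_mx R m n) & forall ti,
    [/\ measurable (W ti),
    [set X | [/\ Z (ti.1 + T)%N ti.2 X, S X & forall r : R, 0 < r ->
      (2%:E * nu (ball X r `&` G N) < nu (ball X r))%E]] `<=` W ti &
    (nu (W ti) <= (2 * lam ^+ 3 * c (ti.1 + T)%N)%:E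
      * nu (L (ti.1 + T)%N ti.2 `\` G N))%E]}.
  apply: (@choice _ _ (fun ti (W : set (borel_mx R m n)) =>
    [/\ measurable W,
    [set X | [/\ Z (ti.1 + T)%N ti.2 X, S X & forall r : R, 0 < r ->
      (2%:E * nu (ball X r `&` G N) < nu (ball X r))%E]] `<=` W &
    (nu W <= (2 * lam ^+ 3 * c (ti.1 + T)%N)%:E
      * nu (L (ti.1 + T)%N ti.2 `\` G N))%E])).
  move=> [t i] /=; have NtT : (N <= t + T)%N by rewrite (leq_trans NT)// leq_addl.
  by apply: covers_essential => //; exact: leq_trans NtT.
pose V t := \bigcup_i W (t, i).
have mV t : measurable (V t).
  by apply: bigcupT_measurable => i; have [] := WP (t, i).
have mVV : measurable (\bigcup_t V t) by exact: bigcupT_measurable.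
have nuV t : (nu (V t) <= K%:E * (c (t + T)%N)%:E)%E.
  apply: (@le_trans _ _ (\sum_(0 <= i <oo) nu (W (t, i)))%E).
    by apply: measure_sigma_subadditive => // i; have [] := WP (t, i).
  have mLG i : measurable (L (t + T)%N i `\` G N : set (borel_mx R m n)).
    by apply: measurableD.
  have cl : 0 <= 2 * lam ^+ 3 * c (t + T)%N by rewrite mulr_ge0// ltW.
  apply: (@le_trans _ _ (\sum_(0 <= i <oo)
     ((2 * lam ^+ 3 * c (t + T)%N)%:E * nu (L (t + T)%N i `\` G N)))%E).
    by apply: lee_nneseries => // i _; have [] := WP (t, i).
  rewrite nneseriesZl; last by move=> i _; exact: measure_ge0.
  have := @measure_bigcup _ _ _ nu setT (fun i => L (t + T)%N i `\` G N).
  rewrite (eq_eseriesl (Q := xpredT)); last by move=> i; rewrite in_setT.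
  move=> <- //; last first.
    (* A common point of two thick sets of level [t + T >= N] lies in [G N]; outside [G N] they are
       therefore disjoint, and their masses sum to at most [nu setT]. *)
    apply/trivIsetP => i j _ _ ij; apply/seteqP; split => // X.
    move=> [[Xi nG] [Xj _]]; apply: nG; exists (t + T - N)%N => //.
    rewrite subnKC; last by rewrite (leq_trans NT)// leq_addl.
    by exists i => //; exists j => //=; rewrite eq_sym.
  apply: (@le_trans _ _ ((2 * lam ^+ 3 * c (t + T)%N)%:E * nu setT)%E).
    apply: lee_wpmul2l; rewrite ?lee_fin//.
    by apply: le_measure; rewrite ?inE//; exact: bigcupT_measurable.
  rewrite -(fineK (fin_nu measurableT)) -!EFinM lee_fin /K.
  move: l1 (c_ge0 (t + T)%N) f0; move: (lam ^+ 3) (c _) (fine _) => l c' f.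
  move=> l1 c'0 f0; rewrite -subr_ge0 [leRHS](_ : _ = 2 * l * c'); last ring.
  by rewrite !mulr_ge0//; lra.
exists (W0 `|` \bigcup_t V t); split.
- exact: measurableU.
- move=> X [AX SX]; have [ess|/existsNP[r]] := pselect (forall r : R, 0 < r ->
      (2%:E * nu (ball X r `&` G N) < nu (ball X r))%E).
    right; have [t Tt [i Zti]] := AX T.
    exists (t - T)%N => //; exists i => //.
    by have [_ + _] := WP ((t - T)%N, i); apply => /=; rewrite subnK.
  move=> /not_implyP[r0 /negP]; rewrite -leNgt => le.
  by left; apply: AW0; split => //; exists r.
apply: le_trans (measureU2 _ _ _) _ => //.
rewrite (splitr e) EFinD; apply: leeD.
  apply: le_trans nuW0 _.
  apply: (@le_trans _ _ ((2 * lam ^+ 3)%:E * (e / 2 / (2 * lam ^+ 3))%:E)%E).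
    by apply: lee_wpmul2l; rewrite // lee_fin ltW.
  by rewrite -EFinM mulrC divfK// gt_eqF.
apply: (@le_trans _ _ (\sum_(0 <= t <oo) nu (V t))%E).
  exact: measure_sigma_subadditive.
apply: (@le_trans _ _ (\sum_(0 <= t <oo) (K%:E * (c (t + T)%N)%:E))%E).
  by apply: lee_nneseries => // t _; exact: nuV.
rewrite nneseriesZl; last by move=> t _; rewrite lee_fin.
rewrite (nneseries_addn (f := fun t => (c t)%:E)); last first.
  by move=> t; rewrite lee_fin.
apply: (@le_trans _ _ (K%:E * (e / 2 / K)%:E)%E).
  by apply: lee_wpmul2l; rewrite // lee_fin ltW.
by rewrite -EFinM mulrC divfK// gt_eqF.
Qed.
End transference.

(** * Slabs around integer hyperplanes *)

Lemma slab_open (R : realType) m n (v : 'cV[R]_n) (w eps : 'cV[R]_m) :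
  open (slab v w eps : set 'M[R]_(m, n)).
Proof.
rewrite openE => X slX; apply: (@filter_forall _ 'I_m
  (fun j Y => `|(Y *m v + w) j 0| < eps j 0) (nbhs X)) => j.
set s := \sum_k `|v k 0|.
have s0 : 0 <= s by apply: sumr_ge0.
(* Moving [X] by [d] in the supremum norm changes the coordinate by at most [d * s]; dividing by
   [s + 1] also serves when [v = 0]. *)
have d0 : 0 < (eps j 0 - `|(X *m v + w) j 0|) / (s + 1).
  by rewrite divr_gt0 ?subr_gt0 ?slX//; lra.
apply/nbhs_ballP; exists ((eps j 0 - `|(X *m v + w) j 0|) / (s + 1)) => //.
move=> Y [_ XY] /=.
have -> : Y *m v + w = (X *m v + w) - (X - Y) *m v.
  by rewrite mulmxBl opprB [RHS]addrC addrA subrK.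
rewrite [X in `|X|]mxE; apply: le_lt_trans (ler_normD _ _) _.
rewrite addrC -ltrBrDr [X in `|X|]mxE normrN mxE.
set e := _ / _ in d0 XY.
have -> : eps j 0 - `|(X *m v + w) j 0| = e * (s + 1).
  by rewrite /e divfK// gt_eqF//; lra.
apply: (@le_lt_trans _ _ (e * s)); last by rewrite ltr_pM2l//; lra.
apply: le_trans (ler_norm_sum _ _ _) _; rewrite mulr_sumr; apply: ler_sum => k _.
rewrite normrM ler_wpM2r// !mxE ltW//.
by have := XY j k; rewrite /ball /=.
Qed.

(** Some coordinate is a nonzero integer. Hence normalizing an integer slab by the Euclidean norm of
    [q] never enlarges its half-widths. *)
Lemma intr_sqr_ge1 (R : realType) n (q : 'cV[int]_n) : q != 0 ->
  1 <= \sum_(i < n) ((q i 0)%:~R : R) ^+ 2.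
Proof.
move=> q0; have [i qi] : exists i, q i 0 != 0.
  apply: contrapT => /forallNP all0; move/eqP: q0; apply.
  apply/matrixP => i k; rewrite (ord1 k) mxE; apply/eqP/negbNE/negP/all0.
rewrite (bigD1 i)//= -[leLHS]addr0; apply: lerD; last first.
  by apply: sumr_ge0 => k _; exact: sqr_ge0.
by rewrite -rmorphXn /= -[leLHS]/(1%:~R) ler_int -gtz0_ge1 exprn_even_gt0.
Qed.

Section slabs.
Context {R : realType} {m n : nat}.
Local Notation M := 'M[R]_(m, n).

Definition int_slab (theta eps : 'cV[R]_m) (a : 'cV[int]_n * 'cV[int]_m)
    : set M :=
  [set X | forall j,
     `|(X *m int_vec a.1 + theta - int_vec a.2) j 0| < eps j 0].

Lemma int_slab_open theta eps a : open (int_slab theta eps a).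
Proof.
have -> : int_slab theta eps a = slab (int_vec a.1) (theta - int_vec a.2) eps.
  by apply/seteqP; split => X sl j; have := sl j; rewrite addrA.
exact: slab_open.
Qed.

Lemma int_slab_normalize theta eps a (s : R) : 0 < s ->
  int_slab theta eps a =
  slab (s^-1 *: int_vec a.1) (s^-1 *: (theta - int_vec a.2)) (s^-1 *: eps).
Proof.
move=> s0; have si0 : 0 < s^-1 by rewrite invr_gt0.
have E (X : M) j : (X *m (s^-1 *: int_vec a.1)
    + s^-1 *: (theta - int_vec a.2)) j 0 =
    s^-1 * (X *m int_vec a.1 + theta - int_vec a.2) j 0.
  by rewrite -scalemxAr -scalerDr addrA mxE.
apply/seteqP; split => X sl j.
  by rewrite E [ltRHS]mxE normrM gtr0_norm// ltr_pM2l.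
by have := sl j; rewrite E [X in _ < X -> _]mxE normrM gtr0_norm// ltr_pM2l.
Qed.

Variable nu : {measure set (borel_mx R m n) -> \bar R}.

(** Contraction, applied to the slabs normalized to unit normals with [delta = 2^-t], gives the
    proportions [C * rho^t], a summable geometric sequence. Closure of [E] under scaling keeps the
    normalized half-widths admissible. *)
Lemma slab_transference (E : set 'cV[R]_m) (theta : 'cV[R]_m)
    (eps : nat -> 'cV[R]_m) (A : nat -> set ('cV[int]_n * 'cV[int]_m)) :
  contracting_on E nu ->
  (forall (k : R) e, 0 < k -> E e -> E (k *: e)) ->
  (forall t, E (eps t)) -> (forall t j, 0 < eps t j 0) ->
  (forall r : R, 0 < r -> exists t0, forall t, (t0 <= t)%N ->
     exists j, eps t j 0 < r) ->
  (forall t a, A t a -> a.1 != 0) ->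
  nu.-negligible [set X : M | forall N, exists2 t, (N <= t)%N &
    exists a b, [/\ A t a, A t b, a != b,
      int_slab theta (eps t) a X & int_slab theta (eps t) b X]] ->
  nu.-negligible [set X : M | forall N, exists2 t, (N <= t)%N &
    exists2 a, A t a & int_slab theta (2^-1 ^+ t *: eps t) a X].
Proof.
move=> [_ nufin [lam lam1 dbl] [C [alpha [r0 [C0 al0 r00 con]]]]].
move=> Esc Eeps eps0 epsr A0 overlap.
(* Pairs are numbered by [pickle]; a number that is not the code of a pair in [A t] gives the empty
   set. *)
pose fam e t i : set M := \bigcup_(a in [set a | pickle a = i /\ A t a])
  int_slab theta e a.
have mfam e t i : measurable (fam e t i : set (borel_mx R m n)).
  apply: open_borel_mx; apply: bigcup_open => a _; exact: int_slab_open.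
have [t0 t0P] := epsr _ r00.
pose rho : R := 2^-1 `^ alpha.
have rho0 : 0 < rho by rewrite powR_gt0.
have rho1 : rho < 1.
  suff : 2^-1 `^ alpha < 1 `^ alpha :> R by rewrite powR1.
  by apply: gt0_ltr_powR => //; rewrite ?nnegrE; lra.
have tr : nu.-negligible [set X : M | forall N, exists2 t, (N <= t)%N &
    exists i, fam (2^-1 ^+ t *: eps t) t i X].
  (* Levels start at 1 at least, so that [delta = 2^-t] is strictly below 1. *)
  apply: (@inhomogeneous_transference _ _ _ nu nufin lam lam1 dbl
    (fun t => fam (eps t) t) (fun t => fam (2^-1 ^+ t *: eps t) t)
    (fun t => C * rho ^+ t) _ _ _ _ (maxn 1 t0)) => //.
  - by move=> t; rewrite mulr_ge0 ?exprn_ge0// ltW.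
  - apply: (@le_lt_trans _ _ (C / (1 - rho))%:E); last exact: ltry.
    apply: lime_le; first by apply: is_cvg_nneseries => t _ _;
      rewrite lee_fin mulr_ge0 ?exprn_ge0// ltW.
    apply: nearW => N; rewrite sumEFin lee_fin.
    have := @geometric_le_lim _ N C rho (ltW C0) rho0.
    by rewrite gtr0_norm// => /(_ rho1).
  - move=> t i X; rewrite geq_max => /andP[t1 tt0] [a [ia Aa] Xa] SX.
    pose s : R := Num.sqrt (\sum_(k < n) ((a.1 k 0)%:~R : R) ^+ 2).
    have q1 := intr_sqr_ge1 R (A0 _ _ Aa).
    have s1 : 1 <= s by rewrite -sqrtr1 ler_sqrt//; lra.
    have s0 : 0 < s by lra.
    have si0 : 0 < s^-1 by rewrite invr_gt0.
    have famE e : fam e t i = int_slab theta e a.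
      apply/seteqP; split=> [Y [b [] /=]|Y Ya]; last by exists a.
      by rewrite -ia => /(pcan_inj pickleK) ->.
    have unit : \sum_(k < n) (s^-1 *: int_vec a.1 : 'cV[R]_n) k 0 ^+ 2 = 1.
      under eq_bigr do rewrite !mxE exprMn.
      rewrite -mulr_sumr exprVn.
      rewrite [s ^+ 2]sqr_sqrtr; last first.
        by apply: sumr_ge0 => k _; exact: sqr_ge0.
      rewrite mulVf//.
      by rewrite gt_eqF// (lt_le_trans ltr01 q1).
    have Es : E (s^-1 *: eps t) by exact: Esc.
    have es0 j : 0 < (s^-1 *: eps t) j 0 by rewrite mxE mulr_gt0.
    have mins : (\big[mine/+oo]_(j < m) ((s^-1 *: eps t)%R j 0%R)%:E < r0%:E)%E.
      have [j jr] := t0P _ tt0.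
      rewrite (bigD1 j)//= gt_min; apply/orP; left; rewrite lte_fin mxE.
      apply: le_lt_trans jr; rewrite ler_piMl ?invf_le1//; exact: ltW.
    have d01 : 0 < (2^-1 : R) ^+ t < 1.
      by rewrite exprn_gt0//= exprn_ilt1// ?invf_lt1 ?ltr1n// -lt0n.
    have [|r rr [BL nuB]] :=
        con _ (s^-1 *: (theta - int_vec a.2)) _ _ unit Es es0 mins d01 X _ SX.
      have := int_slab_normalize theta (2^-1 ^+ t *: eps t) a s0.
      by rewrite scalerA (mulrC s^-1) -scalerA => <-.
    exists r => //; split.
      by rewrite famE (int_slab_normalize _ _ _ s0).
    rewrite famE (int_slab_normalize _ _ _ s0) scalerA (mulrC s^-1) -scalerA.
    suff <- : (2^-1 ^+ t) `^ alpha = rho ^+ t by [].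
    by rewrite /rho -!powR_mulrn ?powR_ge0// -!powRrM mulrC.
  - move: overlap; apply: negligibleS => X Xo N; have [t Nt [i [j [ij Xi Xj]]]] := Xo N.
    case: Xi Xj => a [ia Aa] Xa [b [jb Ab] Xb].
    exists t => //; exists a, b; split => //.
    by apply/eqP => ab; move/eqP: ij; apply; rewrite -ia -jb ab.
move: tr; apply: negligibleS => X XA N; have [t Nt [a Aa Xa]] := XA N.
by exists t => //; exists (pickle a), a.
Qed.
End slabs.

(** * Exponents and approximability *)

(** Contraction holds for restrictions of [mu], so the claim is first localized to balls. For finite
    [v >= 0] the bad points form a union over [k] of sets with exponent [v + 1/(k+1)], each null by
    transference from [v + 1/(k+2)]. *)
Lemma exponent_transference (R : realType) m n
    (C : {measure set (borel_mx R m n) -> \bar R} -> Prop)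
    (P : 'M[R]_(m, n) -> 'cV[R]_m -> R -> Prop) :
  (forall X theta w w', w <= w' -> P X theta w' -> P X theta w) ->
  (forall X, P X 0 0) ->
  (forall nu theta (w1 w2 : R), C nu -> 0 <= w1 -> w1 < w2 ->
    nu.-negligible [set X | P X 0 w1] ->
    nu.-negligible [set X | P X theta w2]) ->
  forall (mu : {measure set (borel_mx R m n) -> \bar R}) (v : \bar R),
  locally_ae C mu ->
  {ae mu, forall X : borel_mx R m n,
    ereal_sup [set w%:E | w in [set w | 0 <= w /\ P X 0 w]] = v} ->
  forall theta : 'cV[R]_m, {ae mu, forall X : borel_mx R m n,
    (ereal_sup [set w%:E | w in [set w | (0 <= w)%R /\ P X theta w]] <= v)%E}.
Proof.
move=> Panti P0 core mu v loc homv theta.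
have supP X (t : 'cV[R]_m) (w : R) : 0 <= w -> P X t w ->
    (w%:E <= ereal_sup [set w%:E | w in [set w | (0 <= w)%R /\ P X t w]])%E.
  by move=> w0 Pw; apply: ereal_sup_ubound; exists w.
pose bad : set 'M[R]_(m, n) := [set X |
  ~ (ereal_sup [set w%:E | w in [set w | (0 <= w)%R /\ P X theta w]] <= v)%E].
pose good : set 'M[R]_(m, n) := [set X0 |
  exists (U : set (borel_mx R m n)) (mU : measurable U),
      nbhs (X0 : 'M[R]_(m, n)) U /\ C (mrestr mu mU)].
suff : mu.-negligible (bad `&` good).
  move=> nbg; have := negligibleU nbg loc; apply: negligibleS => X bX.
  by have [gX|ngX] := pselect (good X); [left|right].
apply: negligible_locally => X0 [_ [U [mU [nU CU]]]].
have [r /= r0 rU] := iffLR (nbhs_ballP _ _) nU.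
exists r => //.
suff [A [mA A0 badA]] : (mrestr mu mU).-negligible bad.
  exists (A `&` U); split => //; first exact: measurableI.
  by move=> X [[bX _] /rU UX]; split => //; apply: badA.
have {}homv : (mrestr mu mU).-negligible [set X : 'M[R]_(m, n) |
    ereal_sup [set w%:E | w in [set w | 0 <= w /\ P X 0 w]] <> v].
  have [A [mA A0 hA]] := homv; exists A; split => //.
  apply/eqP; rewrite eq_le measure_ge0 andbT -[leRHS]A0.
  by apply: le_measure; rewrite ?inE//; exact: measurableI.
(* Homogeneous exponents are nonnegative by [P0], so a negative [v] forces the restricted measure to
   vanish. *)
have [v0|v0] := ltP v 0%E.
  apply: negligibleS homv => X _ /=; apply/eqP; rewrite gt_eqF//.
  exact: lt_le_trans v0 (supP _ _ _ _ (P0 X)).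
case: v v0 @bad homv => [v||//] v0 bad homv; last first.
  by apply: negligibleS (negligible_set0 _) => X; apply; rewrite leey.
have : (mrestr mu mU).-negligible (\bigcup_k [set X |
    P X theta (v + k.+1%:R^-1)]).
  apply: negligible_bigcup => k.
  have vk : v + k.+2%:R^-1 < v + k.+1%:R^-1.
    by rewrite ltrD2l ltf_pV2 ?posrE// ltr_nat.
  have vk0 : 0 <= v + k.+2%:R^-1 by rewrite addr_ge0// invr_ge0.
  apply: (core _ _ _ _ CU vk0 vk); apply: negligibleS homv => X /= PX.
  apply/eqP; rewrite gt_eqF//; apply: lt_le_trans (supP _ _ _ vk0 PX).
  by rewrite lte_fin ltrDl invr_gt0.
apply: negligibleS => X /= /negP; rewrite -ltNge => /ereal_sup_gt.
move=> [_ [w [w0 Pw] <-]]; rewrite lte_fin => vw.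
have [k kw] := ltr_add_invr vw.
by exists k => //; apply: Panti Pw; exact: ltW.
Qed.

(** * Distances to integers and dyadic heights *)

Section integer_distance.
Context {R : realType}.

Lemma mx_norm_lt m n (y : 'M[R]_(m, n)) (e : R) : 0 < e ->
  (forall i j, `|y i j| < e) -> `|y| < e.
Proof.
move=> e0 ye; rewrite [ltLHS]mx_normrE.
by apply/bigmax_ltP; split => // -[i j] _; exact: ye.
Qed.

Lemma mx_norm_ge m n (y : 'M[R]_(m, n)) i j : `|y i j| <= `|y|.
Proof.
rewrite [leRHS]mx_normrE.
exact: (le_bigmax _ (fun ij => `|y ij.1 ij.2|) (i, j)).
Qed.

Let dist_int_has_inf m (y : 'cV[R]_m) :
  has_inf [set `|y - int_vec p| | p in [set: 'cV[int]_m]].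
Proof.
split; first by exists `|y - int_vec 0|; exists 0.
by exists 0 => _ [p _ <-].
Qed.

Lemma dist_int_ltP m (y : 'cV[R]_m) (e : R) : dist_int y < e ->
  exists p, forall j, `|(y - int_vec p) j 0| < e.
Proof.
move=> /(inf_lt (dist_int_has_inf y).1)[_ [p _ <-] ye]; exists p => j.
exact: le_lt_trans (mx_norm_ge _ _ _) ye.
Qed.

Lemma dist_int_le m (y : 'cV[R]_m) p : dist_int y <= `|y - int_vec p|.
Proof. by apply: ge_inf; [exact: (dist_int_has_inf y).2|exists p]. Qed.

Lemma intr_norm_lt1 (k : int) : `|k%:~R : R| < 1 -> k = 0.
Proof.
rewrite -intr_norm -[ltRHS]/(1%:~R) ltr_int => k1.
by apply/eqP; rewrite -normr_le0 -ltzD1.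
Qed.

Lemma centred_bound m (y : 'cV[R]_m) j : `|centred y j 0| <= 2^-1.
Proof.
have [/(_ j)/andP[? ?] _] := iffLR (centredP y _) erefl.
by rewrite ler_norml; apply/andP; split; lra.
Qed.

(** The centred value is at most 1/2 in absolute value, and any other representative modulo 1
    differs from it by at least 1. *)
Lemma centred_le m (y : 'cV[R]_m) (k : int) j :
  `|centred y j 0| <= `|y j 0 - k%:~R|.
Proof.
have [cb [p /matrixP/(_ j 0)]] := iffLR (centredP y _) erefl.
have := centred_bound y j; rewrite !mxE; set c := y j 0 - _ => cb' cp.
have [pk|pk] := eqVneq (p j 0) k.
  by rewrite -pk; rewrite (_ : y j 0 - _ = c)//; move: cp; lra.
have : 1 <= `|(p j 0 - k)%:~R : R|.
  by rewrite leNgt; apply/negP => /intr_norm_lt1/eqP; rewrite subr_eq0; exact/negP.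
have -> : y j 0 - k%:~R = (p j 0 - k)%:~R + c by rewrite intrD; move: cp; lra.
have := lerB_normD ((p j 0 - k)%:~R : R) c; lra.
Qed.

Lemma exprV2E k : (2^-1 : R) ^+ k = 2 `^ (- k%:R).
Proof. by rewrite powRN powR_mulrn// exprVn. Qed.

(** Replaces a real height by a level: [t] is least with [Q < 2^((t+1)N)], and minimality gives the
    lower bound. *)
Lemma exp2_bracket (N K : nat) (Q : R) : (0 < N)%N -> 2 ^+ (K * N) <= Q ->
  exists2 t, (K <= t)%N & 2 ^+ (t * N) <= Q < 2 ^+ (t.+1 * N).
Proof.
move=> N0 KQ.
have exQ : exists t, Q < 2 ^+ (t.+1 * N).
  exists (Num.truncn Q); have Q0 : 0 <= Q by rewrite (le_trans _ KQ)// exprn_ge0.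
  have /andP[_ Qt] := truncn_itv Q0.
  apply: lt_le_trans Qt _; rewrite -natrX ler_nat.
  by rewrite (leq_trans (ltnW (ltn_expl _ (ltnSn 1))))// leq_exp2l// leq_pmulr.
have [t Qt tmin] := ex_minnP exQ; exists t; last first.
  rewrite Qt andbT; case: t Qt tmin => [|t] Qt tmin.
    by rewrite mul0n expr0 (le_trans _ KQ)// exprn_ege1// ler1n.
  by rewrite leNgt; apply/negP => /tmin; rewrite ltnn.
have := le_lt_trans KQ Qt; rewrite ltr_eXn2l ?ltr1n//.
by rewrite ltn_pmul2r.
Qed.

End integer_distance.

(** * Approximability with a fixed exponent *)

Section approximability.
Context {R : realType} {m n : nat}.
Implicit Types (X : 'M[R]_(m, n)) (theta : 'cV[R]_m) (w : R).

(** This repeats the condition inside [dioph_exp], as [mult_approximable] does for [dioph_mexp], so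
    that the exponents have by conversion the form treated in [exponent_transference]. *)
Definition approximable X theta w : Prop :=
  forall Q0 : R, exists Q : R, [/\ Q0 <= Q, 1 < Q &
    exists q : 'cV[int]_n, [/\ q != 0,
      dist_int (X *m int_vec q + theta) < Q `^ (- w) &
      (\max_(i < n) `|(q i 0)%R|%N)%:R <= Q]].

Definition mult_approximable X theta w : Prop :=
  forall Q0 : R, exists Q : R, [/\ Q0 <= Q, 1 < Q &
    exists q : 'cV[int]_n, [/\ q != 0,
      \prod_(j < m) `|centred (X *m int_vec q + theta) j 0|
        < Q `^ (- (m%:R * w)) &
      (\prod_(i < n) maxn 1 `|(q i 0)%R|%N)%:R <= Q ^+ n]].

Lemma approximable_le X theta w w' :
  w <= w' -> approximable X theta w' -> approximable X theta w.
Proof.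
move=> ww' ap Q0; have [Q [Q0Q Q1 [q [q0 dq mq]]]] := ap Q0.
exists Q; split => //; exists q; split => //.
by apply: lt_le_trans dq _; rewrite ler_powR ?lerN2// ltW.
Qed.

Lemma mult_approximable_le X theta w w' :
  w <= w' -> mult_approximable X theta w' -> mult_approximable X theta w.
Proof.
move=> ww' ap Q0; have [Q [Q0Q Q1 [q [q0 dq mq]]]] := ap Q0.
exists Q; split => //; exists q; split => //.
apply: lt_le_trans dq _; rewrite ler_powR ?lerN2//; first exact: ltW.
by rewrite ler_wpM2l.
Qed.

Hypothesis n_gt0 : (0 < n)%N.

Let const1_neq0 : const_mx 1 != 0 :> 'cV[int]_n.
Proof. by apply/eqP => /matrixP/(_ (Ordinal n_gt0) 0); rewrite !mxE. Qed.

Lemma approximable0 X : approximable X 0 0.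
Proof.
move=> Q0; exists (Num.max Q0 2); split; first by rewrite le_max lexx.
  by rewrite lt_max ltr1n orbT.
exists (const_mx 1); split => //.
  rewrite oppr0 powRr0; set y := _ + _.
  have [cb [p yp]] := iffLR (centredP y _) erefl.
  apply: le_lt_trans (dist_int_le _ p) _; apply: mx_norm_lt => // i k.
  rewrite (ord1 k) -yp opprB addrC subrK.
  by apply: le_lt_trans (centred_bound _ _) _; rewrite invf_lt1 ?ltr1n.
apply: (@le_trans _ _ 1); last by rewrite le_max ler1n orbT.
by rewrite -[leRHS]/(1%:R) ler_nat; apply/bigmax_leqP => i _; rewrite mxE.
Qed.

Lemma mult_approximable0 X : (0 < m)%N -> mult_approximable X 0 0.
Proof.
move=> m0 Q0; exists (Num.max Q0 2); split; first by rewrite le_max lexx.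
  by rewrite lt_max ltr1n orbT.
exists (const_mx 1); split => //.
  rewrite mulr0 oppr0 powRr0; set y := _ + _.
  apply: (@le_lt_trans _ _ (\prod_(j < m) 2^-1)).
    by apply: ler_prod => j _; rewrite normr_ge0 centred_bound.
  by rewrite prodr_const card_ord exprn_ilt1 ?invf_lt1 ?ltr1n// -lt0n.
rewrite big1 ?exprn_ege1 ?le_max ?ler1n ?orbT// => i _.
by rewrite mxE.
Qed.

End approximability.

(** Subtraction cancels [theta], which turns overlaps of slabs into homogeneous approximations. *)
Lemma int_slab_diff (R : realType) m n (X : 'M[R]_(m, n))
    (theta eps : 'cV[R]_m) (a b : 'cV[int]_n * 'cV[int]_m) :
  int_slab theta eps a X -> int_slab theta eps b X ->
  forall j, `|(X *m int_vec (a.1 - b.1)) j 0 - ((a.2 - b.2) j 0)%:~R|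
    < 2 * eps j 0.
Proof.
move=> aX bX j; have := aX j; have := bX j.
have -> : (X *m int_vec (a.1 - b.1)) j 0 - ((a.2 - b.2) j 0)%:~R =
    (X *m int_vec a.1 + theta - int_vec a.2) j 0 -
    (X *m int_vec b.1 + theta - int_vec b.2) j 0.
  have -> : int_vec (a.1 - b.1) = int_vec a.1 - int_vec b.1 :> 'cV[R]_n.
    by rewrite /int_vec map_mxB.
  rewrite mulmxBr; move: (X *m int_vec a.1) (X *m int_vec b.1) => P Q.
  by rewrite !mxE rmorphB/=; ring.
move=> blt alt; apply: le_lt_trans (ler_normB _ _) _.
by rewrite mulr_natl mulr2n ltrD.
Qed.

(** If both [q] agree, the coordinates of the difference of the [p] are integers below
    [2 * eps j 0], hence 0 where this is at most 1. Smallness is asked only where the [p] differ,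
    which spares the wide coordinates of the multiplicative case. *)
Lemma int_slab_diff_neq0 (R : realType) m n (X : 'M[R]_(m, n))
    (theta eps : 'cV[R]_m) (a b : 'cV[int]_n * 'cV[int]_m) :
  (forall j, a.2 j 0 != b.2 j 0 -> 2 * eps j 0 <= 1) ->
  a != b -> int_slab theta eps a X -> int_slab theta eps b X ->
  a.1 - b.1 != 0.
Proof.
move=> small ab aX bX; apply: contra_neq ab => ab1.
case: a b small aX bX ab1 => a1 a2 [b1 b2] /= small aX bX ab1.
have E : a1 = b1 by apply/eqP; rewrite -subr_eq0 ab1.
congr (_, _) => //; apply/matrixP => j k; rewrite (ord1 k).
apply/eqP; apply: contraT => abj; have := int_slab_diff aX bX j => /=.
rewrite ab1 /int_vec map_mx0 mulmx0 mxE sub0r normrN => lt.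
have := intr_norm_lt1 (lt_le_trans lt (small _ abj)); rewrite !mxE.
by move=> /eqP; rewrite subr_eq0 (negPf abj).
Qed.

(** * Comparisons of powers of two *)

Section powers_of_two.
Context {R : realType}.

Lemma exprV2_le k (x : R) : x <= k%:R -> 2^-1 ^+ k <= 2 `^ (- x).
Proof. by move=> xk; rewrite exprV2E ler_powR ?lerN2 ?ler1n. Qed.

Lemma le_exprV2 k (x : R) : k%:R <= x -> 2 `^ (- x) <= 2^-1 ^+ k.
Proof. by move=> xk; rewrite exprV2E ler_powR ?lerN2 ?ler1n. Qed.

Lemma exp2_powRN k (w : R) : (2 ^+ k) `^ (- w) = 2 `^ (- (k%:R * w)).
Proof. by rewrite -powR_mulrn// -powRrM mulrN. Qed.

Lemma powRN_le (x y w : R) : 0 < x -> x <= y -> 0 <= w ->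
  y `^ (- w) <= x `^ (- w).
Proof.
move=> x0 xy w0; have y0 := lt_le_trans x0 xy.
rewrite !powRN lef_pV2 ?posrE ?powR_gt0// ge0_ler_powR//.
- by rewrite nnegrE ltW.
- by rewrite nnegrE ltW.
Qed.

Lemma exp2_unbounded (x : R) : exists t0, forall t, (t0 <= t)%N -> x <= 2 ^+ t.
Proof.
exists (Num.truncn `|x|).+1 => t xt.
have /andP[_ /ltW x1] := truncn_itv (normr_ge0 x).
apply: le_trans (ler_norm x) _; apply: le_trans x1 _.
by rewrite -natrX ler_nat (leq_trans xt)// ltnW// ltn_expl.
Qed.

Lemma exprV2_small (x : R) : 0 < x ->
  exists t0, forall t, (t0 <= t)%N -> 2^-1 ^+ t < x.
Proof.
move=> x0; have [t0 t0P] := exp2_unbounded (x^-1 + 1); exists t0 => t /t0P xt.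
rewrite exprVn invf_plt ?posrE ?exprn_gt0//.
by apply: lt_le_trans xt; rewrite ltrDl.
Qed.

Lemma natr_unbounded (x : R) : exists k : nat, x <= k%:R.
Proof.
exists (Num.truncn `|x|).+1; apply: le_trans (ler_norm x) _.
by have /andP[_ /ltW] := truncn_itv (normr_ge0 x).
Qed.
End powers_of_two.

(** * The simultaneous case *)

Section simultaneous.
Context {R : realType} {m n : nat}.
Variables (nu : {measure set (borel_mx R m n) -> \bar R}) (theta : 'cV[R]_m).
Variables w1 w2 : R.
Hypotheses (m_gt0 : (0 < m)%N) (w1_ge0 : 0 <= w1) (w12 : w1 < w2).
Hypothesis nu_con : contracting nu.
Hypothesis hom : nu.-negligible [set X | approximable X 0 w1].

Lemma contracting_transference :
  nu.-negligible [set X | approximable X theta w2].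
Proof.
have w10 := w1_ge0; have w12' := w12.
(* The slack [4 + w1] covers the growth of the height from [b^N] to [b^(N+1)] and the rounding
   below: [(N+1) w1 <= N w2 - 4 < k]. *)
have [N [N_gt0 NP]] : exists N, (0 < N)%N /\ 4 + w1 <= N%:R * (w2 - w1).
  have [N NP] := natr_unbounded ((4 + w1) / (w2 - w1)); exists N.+1; split => //.
  by rewrite -ler_pdivrMr ?subr_gt0//; apply: le_trans NP _; rewrite ler_nat.
have Nw1 : 0 <= N%:R * w1 by rewrite mulr_ge0.
have Nw2 : 0 <= N%:R * w2 by move: NP; rewrite mulrBr; lra.
have /andP[] := truncn_itv Nw2.
(* Now [k + 3 <= N w2 < k + 4]: the lower bound on [N w2] lets the thin slabs catch exponent [w2],
   the upper one makes the thick slabs narrow enough for [w1]. *)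
have [k ->] : exists k, Num.truncn (N%:R * w2) = (k + 3)%N.
  have : (4 <= Num.truncn (N%:R * w2))%N.
    by rewrite truncn_ge_nat//; move: NP; rewrite mulrBr; lra.
  by exists (Num.truncn (N%:R * w2) - 3)%N; rewrite subnK// ltnW.
rewrite natrD -addn1 !natrD => kN Nk.
have kw1 : N.+1%:R * w1 <= k%:R.
  by rewrite -addn1 natrD mulrDl mul1r; move: NP; rewrite mulrBr; lra.
(* Scale b = 2^t: heights up to b^N, thin width b^-(k+2), thick b^-(k+1). *)
pose eps t : 'cV[R]_m := const_mx (2^-1 ^+ (t * k.+1)).
pose A t : set ('cV[int]_n * 'cV[int]_m) :=
  [set a : 'cV[int]_n * 'cV[int]_m | a.1 != 0 /\
     forall i, (`|(a.1 i 0)%R|%N <= 2 ^ (t * N))%N].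
have eps2 t : (0 < t)%N -> 2 * 2^-1 ^+ (t * k.+1) <= 2^-1 ^+ (t * k) :> R.
  move=> t0; rewrite mulnS exprD mulrA ler_piMl ?exprn_ge0//.
  rewrite exprVn ler_pdivrMr ?exprn_gt0// mul1r.
  by rewrite -[leLHS]expr1 ler_eXn2l// ltr1n.
have [] // := @slab_transference R m n nu _ theta eps A nu_con.
- by move=> c e c0 Ee i j /=; rewrite !mxE (Ee i j).
- by move=> t i j; rewrite !mxE.
- by move=> t j; rewrite mxE exprn_gt0.
- move=> r r0; have [t0 t0P] := exprV2_small r0; exists t0 => t tt0.
  exists (Ordinal m_gt0); rewrite mxE; apply: t0P.
  by rewrite (leq_trans tt0)// leq_pmulr.
- by move=> t a [].
- move: hom; apply: negligibleS => X Xo Q0.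
  have [t0 t0P] := exp2_unbounded Q0.
  have [t + [a [b [Aa Ab ab aX bX]]]] := Xo (maxn 1 t0).
  rewrite geq_max => /andP[t1 tt0].
  (* The difference has height at most [2 b^N <= b^(N+1)] and error below [2 b^-(k+1) <= b^-k]. *)
  exists (2 ^+ (t * N.+1)); split.
  + apply: le_trans (t0P _ tt0) _.
    by rewrite ler_eXn2l ?ltr1n// leq_pmulr.
  + by rewrite exprn_egt1 ?ltr1n// muln_eq0 negb_or -lt0n t1.
  exists (a.1 - b.1); split.
  + apply: int_slab_diff_neq0 ab aX bX => j _; rewrite mxE.
    by apply: le_trans (eps2 _ t1) _; rewrite exprn_ile1// invf_le1// ler1n.
  + apply: le_lt_trans (dist_int_le _ (a.2 - b.2)) _.
    apply: (@lt_le_trans _ _ (2 * 2^-1 ^+ (t * k.+1))).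
      apply: mx_norm_lt; first by rewrite mulr_gt0// exprn_gt0.
      move=> i j; rewrite (ord1 j) addr0; have := int_slab_diff aX bX i.
      have -> : eps t i 0 = 2^-1 ^+ (t * k.+1) by rewrite mxE.
      move: (X *m _) => Y; suff -> : (Y - int_vec (a.2 - b.2)) i 0 =
        Y i 0 - ((a.2 - b.2) i 0)%:~R by [].
      by rewrite mxE [X in _ + X]mxE [X in - X]mxE.
    apply: le_trans (eps2 _ t1) _; rewrite exp2_powRN; apply: exprV2_le.
    by rewrite !natrM -mulrA ler_wpM2l.
  + rewrite -natrX ler_nat; apply/bigmax_leqP => i _.
    have := Aa.2 i; have := Ab.2 i; rewrite !mxE mulnS expnD => bi ai.
    have t2 : (2 <= 2 ^ t)%N by rewrite -[leqLHS]expn1 leq_exp2l.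
    apply: leq_trans _ (leq_mul t2 (leqnn _)); rewrite mul2n -addnn.
    apply: leq_trans _ (leq_add ai bi).
    by move: (a.1 i 0) (b.1 i 0) => x y; lia.
move=> W [mW W0 AW]; exists W; split => // X Xap; apply: AW => T.
(* The bound [Q < 2^((t+1)N)] forces the use of level [t + 1]. With [x = N w2], taking [t >= x]
   absorbs this shift: [(t+1)(x-1) <= t x]. *)
have [K NK] := natr_unbounded (N%:R * w2).
have [Q [Q0 Q1 [q [q0 dq mq]]]] := Xap (2 ^+ ((T + K) * N)).
have [t TKt /andP[Qt tQ]] := exp2_bracket N_gt0 Q0.
exists t.+1; first by rewrite (leq_trans (leq_addr K T))// ltnW.
have [p pP] := dist_int_ltP dq.
exists (q, p).
  split => //= i; have := le_lt_trans mq tQ.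
  rewrite -natrX ltr_nat => /ltnW; apply: leq_trans.
  by rewrite (bigD1 i)//= leq_max leqnn.
move=> j; have -> : (2^-1 ^+ t.+1 *: eps t.+1) j 0 = 2^-1 ^+ (t.+1 * k.+2).
  by rewrite !mxE -exprD -mulnS.
apply: lt_le_trans (pP j) _.
apply: le_trans (powRN_le _ Qt _) _; first by rewrite exprn_gt0.
  by rewrite ltW// (le_lt_trans w1_ge0).
rewrite exp2_powRN; apply: le_exprV2.
have tK : N%:R * w2 <= t%:R.
  by apply: le_trans NK _; rewrite ler_nat (leq_trans _ TKt)// leq_addl.
have := kN; rewrite !natrM -mulrA; move: tK; move: (N%:R * w2) => x xt kx.
rewrite -[t.+1]addn1 -[k.+2]addn2 !natrD.
have kx' : k%:R + 2 <= x - 1 by lra.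
have t0 : (0 : R) <= t%:R by [].
apply: (@le_trans _ _ ((t%:R + 1) * (x - 1))); last by nra.
by rewrite ler_wpM2l//; lra.
Qed.
End simultaneous.

(** * The multiplicative case *)

Lemma ltr_powR_exp2 (R : realType) (x y : R) : x < y -> 2 `^ x < 2 `^ y.
Proof.
by move=> xy; rewrite /powR pnatr_eq0/= ltr_expR ltr_pM2r// ln_gt0// ltr1n.
Qed.

Section multiplicative.
Context {R : realType} {m n : nat}.
Variables (theta : 'cV[R]_m) (N : nat).

(* The classes of level [t], in the scale b = 2^t and for the height b^N:
   coordinate [j] of X q + theta - p is below b^(- u j), and max(1, |q i|) lies
   below b^(h i + 1). Where [u j <= 1] widening by b would reach several [p j] at
   once; there the half-width is instead so large that it imposes no condition on
   X with |X| <= t, and [p j] is fixed to 0. *)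
Definition class_eps (u : 'I_m -> nat) (t : nat) : 'cV[R]_m :=
  \col_j (if (1 < u j)%N then 2^-1 ^+ (t * (u j).-1)
  else 2 ^+ t * (t%:R * n%:R * 2 ^+ (t * (N * n).+1) + `|theta| + 1)).

Definition class_idx (u : 'I_m -> nat) (h : 'I_n -> nat) (t : nat) :
    set ('cV[int]_n * 'cV[int]_m) :=
  [set a : 'cV[int]_n * 'cV[int]_m | [/\ a.1 != 0,
    forall i, (maxn 1 `|(a.1 i 0)%R| < 2 ^ (t * (h i).+1))%N &
    forall j, (u j <= 1)%N -> a.2 j 0 = 0]].

Lemma class_eps_gt0 u t j : 0 < class_eps u t j 0.
Proof.
rewrite mxE; case: ifP => _; first by rewrite exprn_gt0.
by rewrite mulr_gt0 ?exprn_gt0// ltr_wpDl// addr_ge0// !mulr_ge0// exprn_ge0.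
Qed.

(** [u] is the largest admissible value, 0 being one. The cap [M] covers [x = 0] and keeps the
    number of classes finite. *)
Lemma geometric_level (t M : nat) (x : R) : x < 1 -> exists u, [/\ (u <= M)%N,
  x < 2^-1 ^+ (t * u) & u = M \/ 2^-1 ^+ (t * u.+1) <= x].
Proof.
move=> x1.
have ex0 : exists u, (u <= M)%N && (x < 2^-1 ^+ (t * u)).
  by exists 0%N; rewrite muln0 expr0.
have bd u : (u <= M)%N && (x < 2^-1 ^+ (t * u)) -> (u <= M)%N by case/andP.
have [u /andP[uM xu] umax] := ex_maxnP ex0 bd; exists u; split => //.
have [uM'|uM'] := eqVneq u M; [by left|right].
rewrite leNgt; apply/negP => xu1.
have := umax u.+1; rewrite ltn_neqAle uM' uM xu1 ltnn.
by move=> /(_ isT).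
Qed.

Lemma row_bound (X : 'M[R]_(m, n)) (q : 'cV[int]_n) (r b : R) j :
  0 <= r -> `|X| <= r -> (forall i, `|(q i 0)%:~R : R| <= b) ->
  `|(X *m int_vec q + theta) j 0| <= r * n%:R * b + `|theta|.
Proof.
move=> r0 Xr qb; rewrite mxE; apply: le_trans (ler_normD _ _) _.
apply: lerD; last exact: mx_norm_ge.
rewrite mxE; apply: le_trans (ler_norm_sum _ _ _) _.
apply: (@le_trans _ _ (\sum_(i < n) r * b)).
  apply: ler_sum => i _; rewrite mxE normrM; apply: ler_pM => //.
  exact: le_trans (mx_norm_ge _ _ _) Xr.
by rewrite sumr_const card_ord -[leLHS]mulr_natl mulrCA mulrA.
Qed.

Variable w2 : R.
Hypotheses (N_gt0 : (0 < N)%N) (w2_ge0 : 0 <= w2).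

(** What the two product conditions leave on a class: the [b^(h i)] multiply to at most [b^(N n)],
    and the [u j + 1] sum to at least [N m w2 - 1]. The term [m] comes from rounding each [u j], the
    1 from rounding [Q]. *)
Definition admissible (u : 'I_m -> nat) (h : 'I_n -> nat) : Prop :=
  (\sum_i h i <= N * n)%N /\
  N%:R * (m%:R * w2) <= (\sum_j u j)%:R + m%:R + 1.

Lemma mult_approximable_class (M : nat) (X : 'M[R]_(m, n)) :
  N%:R * (m%:R * w2) <= M%:R ->
  mult_approximable X theta w2 -> forall T, exists2 t, (T <= t)%N &
    exists (u : {ffun 'I_m -> 'I_M.+1}) (h : {ffun 'I_n -> 'I_(N * n).+1}),
    admissible (fun j => u j) (fun i => h i) /\
    exists2 a, class_idx (fun j => u j) (fun i => h i) t a &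
      int_slab theta (2^-1 ^+ t *: class_eps (fun j => u j) t) a X.
Proof.
move=> WM Xap T.
have [W WE] : exists W, W = N%:R * (m%:R * w2) by exists (N%:R * (m%:R * w2)).
rewrite -WE in WM.
have [K1 K1P] := natr_unbounded W.
have [K2 K2P] := natr_unbounded `|X|.
(* The three summands make the level at least [T], [N m w2] and the norm of [X]. *)
have [Q [Q0 Q1 [q [q0 dq mq]]]] := Xap (2 ^+ ((T + K1 + K2) * N)).
have [s Ks /andP[Qs sQ]] := exp2_bracket N_gt0 Q0.
pose t := s.+1; exists t; first by rewrite /t; lia.
have tX : `|X| <= t%:R by apply: le_trans K2P _; rewrite ler_nat /t; lia.
have sW : W <= s%:R by apply: le_trans K1P _; rewrite ler_nat; lia.
have t2 : (1 < 2 ^ t)%N by rewrite -[ltnLHS](expn0 2) ltn_exp2l.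
have hsum : (\sum_i trunc_log (2 ^ t) (maxn 1 `|(q i 0)%R|) <= N * n)%N.
  rewrite -(leq_exp2l _ _ t2) expn_sum.
  apply: (@leq_trans (\prod_(i < n) maxn 1 `|(q i 0)%R|)).
    by apply: leq_prod => i _; apply: trunc_logP => //; rewrite leq_max.
  rewrite -(ler_nat R) (le_trans mq)// natrX natrX -exprM mulnA exprM.
  by rewrite lerXn2r ?nnegrE ?exprn_ge0// ?(le_trans _ (ltW Q1))// ltW.
have hle i : (trunc_log (2 ^ t) (maxn 1 `|(q i 0)%R|) < (N * n).+1)%N.
  by rewrite ltnS (leq_trans _ hsum)// (bigD1 i)//= leq_addr.
pose h := [ffun i => Ordinal (hle i)].
set y := X *m int_vec q + theta in dq.
have [u uP] : {u : 'I_m -> nat & forall j, [/\ (u j <= M)%N,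
    `|centred y j 0| < 2^-1 ^+ (t * u j) &
    u j = M \/ 2^-1 ^+ (t * (u j).+1) <= `|centred y j 0|]}.
  apply: (@choice _ _ (fun j u => [/\ (u <= M)%N,
    `|centred y j 0| < 2^-1 ^+ (t * u) &
    u = M \/ 2^-1 ^+ (t * u.+1) <= `|centred y j 0|])) => j.
  apply: geometric_level; apply: le_lt_trans (centred_bound _ _) _.
  by rewrite invf_lt1 ?ltr1n.
have uM j : (u j < M.+1)%N by rewrite ltnS; have [] := uP j.
pose u' := [ffun j => Ordinal (uM j)].
have u'E j : u' j = u j :> nat by rewrite ffunE.
have hE i : h i = trunc_log (2 ^ t) (maxn 1 `|(q i 0)%R|) :> nat.
  by rewrite ffunE.
exists u', h; split.
  split; first by under eq_bigr do rewrite hE.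
  rewrite -WE.
  under eq_bigr do rewrite u'E.
  (* A coordinate at the cap alone gives a sum of at least [M >= N m w2]. Otherwise the lower bounds
     [b^-(u j + 1)] multiply. *)
  have [[j ujM]|noM] := pselect (exists j, u j = M).
    apply: le_trans WM _; rewrite -addrA -[leLHS]addr0; apply: lerD => //.
    by rewrite ler_nat -ujM (bigD1 j)//= leq_addr.
  have : 2 `^ (- (t * (\sum_j u j + m))%:R) < 2 `^ (- (s%:R * W)) :> R.
    rewrite -exprV2E.
    have -> : (2^-1 : R) ^+ (t * (\sum_j u j + m)) =
        \prod_(j < m) 2^-1 ^+ (t * (u j).+1).
      rewrite prodrXr; congr (_ ^+ _); rewrite -big_distrr/=; congr (_ * _)%N.
      by under [RHS]eq_bigr do rewrite -addn1; rewrite big_split/= sum1_card card_ord.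
    apply: (@le_lt_trans _ _ (\prod_(j < m) `|centred y j 0|)).
      apply: ler_prod => j _; rewrite exprn_ge0//=.
      by have [_ _ [ujM|//]] := uP j; case: noM; exists j.
    apply: lt_le_trans dq _; apply: le_trans (powRN_le _ Qs _) _.
    - by rewrite exprn_gt0.
    - by rewrite mulr_ge0.
    - by rewrite exp2_powRN natrM -mulrA WE.
  apply: contraTT; rewrite -ltNge -leNgt => uW; rewrite ler_powR ?ler1n// lerN2.
  rewrite natrM natrD /t -addn1 natrD; move: uW sW.
  move: (\sum_j u j)%:R (m%:R : R) s%:R (ler0n R s) (W : R) => a b x x0 W'.
  move=> aW xW; apply: (@le_trans _ _ ((x + 1) * (W' - 1))); last by nra.
  by rewrite ler_wpM2l//; lra.
pose p : 'cV[int]_m :=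
  \col_j (if (1 < u j)%N then Num.floor (y j 0 + 2^-1) else 0).
exists (q, p).
  split => //= [i|j]; first by rewrite hE expnM trunc_log_ltn.
  by rewrite u'E /p mxE ltnNge => ->.
move=> j; rewrite [ltRHS]mxE [class_eps _ _ _ _]mxE u'E.
have -> : (y - int_vec p) j 0 = y j 0 - (p j 0)%:~R.
  by rewrite mxE [X in _ + X]mxE [X in - X]mxE.
rewrite /p mxE; case: ifPn => [u1|u1].
  have [_ + _] := uP j; rewrite mxE => /lt_le_trans; apply.
  by rewrite -exprD -mulnS prednK// ltnW.
(* The factor [2^t] in the wide half-width cancels the thinning [2^-t], and its summand 1 makes the
   bound of [row_bound] strict. *)
rewrite subr0 mulrA -exprMn mulVf// expr1n mul1r.
apply: le_lt_trans (row_bound (b := 2 ^+ (t * (N * n).+1)) _ _ tX _) _ => // [i|]; last first.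
  by rewrite ltrDl.
rewrite -intr_norm -abszE -natrX [leLHS]/(_%:R) ler_nat.
apply: (@leq_trans (maxn 1 `|(q i 0)%R|)); first by rewrite leq_max leqnn orbT.
apply: (@leq_trans (2 ^ (t * (h i).+1))).
  by rewrite hE expnM ltnW// trunc_log_ltn.
by rewrite leq_exp2l// leq_pmul2l// ltn_ord.
Qed.

Variables (nu : {measure set (borel_mx R m n) -> \bar R}) (w1 : R).
Hypotheses (m_gt0 : (0 < m)%N) (w1_ge0 : 0 <= w1).
Hypothesis NP :
  3 * m%:R + 2 + N.+2%:R * (m%:R * w1) <= N%:R * (m%:R * w2).
Hypothesis nu_con : strongly_contracting nu.
Hypothesis hom : nu.-negligible [set X | mult_approximable X 0 w1].

(** An overlap gives a homogeneous approximation at [Q = b^(N+2)]: coordinate [i] of [q - q'] is at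
    most [b^(h i + 2)], and the errors multiply to at most [b] to the power minus the sum of the
    [u j - 2], which is below [Q^-(m w1)] by [NP]. *)
Lemma class_negligible (u : 'I_m -> nat) (h : 'I_n -> nat) :
  admissible u h ->
  nu.-negligible [set X | forall T, exists2 t, (T <= t)%N &
    exists2 a, class_idx u h t a &
      int_slab theta (2^-1 ^+ t *: class_eps u t) a X].
Proof.
move=> [hsum usum].
have V0 : 0 <= m%:R * w1 by rewrite mulr_ge0.
(* If no [u j] exceeded 1, their sum would be at most [m], against [NP]. This coordinate supplies
   the small half-width that contraction requires. *)
have [j0 uj0] : exists j, (1 < u j)%N.
  apply: contrapT => /forallNP small.
  have : (\sum_j u j)%:R <= m%:R :> R.
    rewrite ler_nat -[leqRHS]card_ord -sum1_card; apply: leq_sum => j _.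
    by rewrite leqNgt; apply/negP/small.
  have NV : 0 <= N.+2%:R * (m%:R * w1) by rewrite mulr_ge0.
  have m1 : 1 <= m%:R :> R by rewrite ler1n.
  by have := NP; move: usum NV; set W := N%:R * _; set V := N.+2%:R * _; lra.
(* Subtraction is truncated: a wide coordinate contributes 0, matching the trivial bound 1 for its
   error. *)
have uv : (\sum_j u j <= \sum_j (u j - 2) + 2 * m)%N.
  rewrite mulnC -[X in (X * 2)%N]card_ord -sum_nat_const -big_split/=.
  by apply: leq_sum => j _; lia.
have eps_le t j : (0 < t)%N -> (1 < u j)%N ->
    2 * class_eps u t j 0 <= 2^-1 ^+ (t * (u j - 2)).
  move=> t0 uj; rewrite mxE uj.
  rewrite (_ : (u j).-1 = (u j - 2).+1); last lia.
  rewrite mulnS exprD mulrA ler_piMl ?exprn_ge0//.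
  rewrite exprVn ler_pdivrMr ?exprn_gt0// mul1r.
  by rewrite -[leLHS]expr1 ler_eXn2l// ltr1n.
apply: (slab_transference (eps := class_eps u) (A := class_idx u h) nu_con).
- by [].
- by [].
- exact: class_eps_gt0.
- move=> r r0; have [t0 t0P] := exprV2_small r0; exists t0 => t tt0.
  exists j0; rewrite mxE uj0; apply: t0P.
  by rewrite (leq_trans tt0)// leq_pmulr//; lia.
- by move=> t a [].
move: hom; apply: negligibleS => X Xo Q0.
have [t0 t0P] := exp2_unbounded Q0.
have [t + [a [b [[_ ah ap] [_ bh bp] ab aX bX]]]] := Xo (maxn 1 t0).
rewrite geq_max => /andP[t1 tt0].
exists (2 ^+ (t * N.+2)); split.
- apply: le_trans (t0P _ tt0) _.
  by rewrite ler_eXn2l ?ltr1n// leq_pmulr.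
- by rewrite exprn_egt1 ?ltr1n// muln_eq0 negb_or -lt0n t1.
exists (a.1 - b.1); split.
- apply: int_slab_diff_neq0 ab aX bX => j abj.
  have uj : (1 < u j)%N.
    by rewrite ltnNge; apply: contra abj => uj; rewrite ap// bp.
  apply: le_trans (eps_le _ _ t1 uj) _.
  by rewrite exprn_ile1// invf_le1// ler1n.
- rewrite addr0; apply: (@le_lt_trans _ _
    (\prod_(j < m) 2^-1 ^+ (t * (u j - 2)))).
    apply: ler_prod => j _; rewrite normr_ge0/=.
    have [uj|uj] := ltnP 1 (u j).
      apply: le_trans (centred_le _ ((a.2 - b.2) j 0) _) _.
      by apply: le_trans (ltW (int_slab_diff aX bX j)) _; exact: eps_le.
    rewrite (_ : u j - 2 = 0)%N ?muln0; last lia.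
    rewrite expr0.
    by apply: le_trans (centred_bound _ _) _; rewrite invf_le1 ?ler1n.
  rewrite prodrXr -big_distrr/= exprV2E exp2_powRN; apply: ltr_powR_exp2.
  rewrite ltrN2 !natrM -mulrA ltr_pM2l ?ltr0n//.
  have := NP; move: usum; move: uv; rewrite -(ler_nat R) natrD natrM.
  by set W := N%:R * _; set V := N.+2%:R * _; lra.
rewrite -!natrX ler_nat -expnM.
apply: (@leq_trans (\prod_(i < n) 2 ^ (t * (h i).+2))).
  apply: leq_prod => i _; rewrite geq_max expn_gt0/= !mxE mulnS expnD.
  have t2 : (2 <= 2 ^ t)%N by rewrite -[leqLHS]expn1 leq_exp2l.
  apply: leq_trans _ (leq_mul t2 (leqnn _)); rewrite mul2n -addnn.
  have := ah i; have := bh i; rewrite !gtn_max => /andP[_ bi] /andP[_ ai].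
  apply: leq_trans _ (leq_add (ltnW ai) (ltnW bi)).
  by move: (a.1 i 0) (b.1 i 0) => x y; lia.
rewrite -expn_sum -big_distrr/= leq_exp2l// -mulnA leq_pmul2l//.
under eq_bigr do rewrite -addn2; rewrite big_split/= sum_nat_const card_ord.
by rewrite -[N.+2]addn2 mulnDl [(2 * n)%N]mulnC leq_add2r.
Qed.
End multiplicative.

(** * Reduction to finitely many classes and conclusion *)

Lemma infinitely_often_pigeonhole (K : finType) (P : nat -> K -> Prop) :
  (forall T, exists2 t, (T <= t)%N & exists k, P t k) ->
  exists k, forall T, exists2 t, (T <= t)%N & P t k.
Proof.
move=> io; apply: contrapT => /forallNP none.
have [B BP] : {B : K -> nat & forall k t, (B k <= t)%N -> ~ P t k}.
  apply: (@choice _ _ (fun k T => forall t, (T <= t)%N -> ~ P t k)) => k.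
  have /existsNP[T TP] := none k; exists T => t Tt Ptk.
  by apply: TP; exists t.
have [t Bt [k Ptk]] := io (\max_k B k); apply: BP Ptk.
by apply: leq_trans Bt; rewrite (bigD1 k)//= leq_maxl.
Qed.

Lemma strongly_contracting_transference (R : realType) m n
    (nu : {measure set (borel_mx R m n) -> \bar R}) (theta : 'cV[R]_m)
    (w1 w2 : R) :
  (0 < m)%N -> 0 <= w1 -> w1 < w2 -> strongly_contracting nu ->
  nu.-negligible [set X | mult_approximable X 0 w1] ->
  nu.-negligible [set X | mult_approximable X theta w2].
Proof.
move=> m_gt0 w10 w12 nu_con hom.
have w20 : 0 <= w2 by rewrite ltW// (le_lt_trans w10).
(* [c] gathers the terms of the condition on [N] that do not grow with [N]; what remains is
   [c <= N m (w2 - w1)]. *)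
pose c := 3 * m%:R + 2 + 2 * (m%:R * w1).
have [N [N_gt0 NP]] : exists N, (0 < N)%N /\
    3 * m%:R + 2 + N.+2%:R * (m%:R * w1) <= N%:R * (m%:R * w2).
  have [N NP] := natr_unbounded (c / (m%:R * (w2 - w1))).
  exists N.+1; split => //.
  have mw : 0 < m%:R * (w2 - w1) by rewrite mulr_gt0 ?ltr0n// subr_gt0.
  have : c <= N.+1%:R * (m%:R * (w2 - w1)).
    by rewrite -ler_pdivrMr//; apply: le_trans NP _; rewrite ler_nat.
  rewrite /c mulrBr mulrBr -[N.+3]addn2 natrD mulrDl.
  by move: (_ * _) (_ * _) => x y; lra.
have [M MP] := natr_unbounded (N%:R * (m%:R * w2)).
pose K := ({ffun 'I_m -> 'I_M.+1} * {ffun 'I_n -> 'I_(N * n).+1})%type.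
pose P (X : 'M[R]_(m, n)) t (k : K) :=
  admissible N w2 (fun j => k.1 j) (fun i => k.2 i) /\
  exists2 a, class_idx (fun j => k.1 j) (fun i => k.2 i) t a &
  int_slab theta (2^-1 ^+ t *: @class_eps R m n theta N (fun j => k.1 j) t) a X.
pose F i : set 'M[R]_(m, n) := if unpickle i is Some k then
  [set X | forall T, exists2 t, (T <= t)%N & P X t k] else set0.
have : nu.-negligible (\bigcup_i F i).
  apply: negligible_bigcup => i; rewrite /F.
  case: unpickle => [k|]; last exact: negligible_set0.
  have [adm|nadm] := pselect (admissible N w2 (fun j => k.1 j) (fun i => k.2 i)).
    have := class_negligible theta N_gt0 w20 m_gt0 w10 NP nu_con hom adm.
    by apply: negligibleS => X XP T; have [t Tt [_ Pt]] := XP T; exists t.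
  apply: negligibleS (negligible_set0 _) => X XP.
  by have [t _ [adm _]] := XP 0%N.
apply: negligibleS => X Xap.
have [T|k kP] := @infinitely_often_pigeonhole K (P X).
  have [t Tt [u [h uh]]] := mult_approximable_class N_gt0 w20 MP Xap T.
  by exists t => //; exists (u, h).
by exists (pickle k) => //; rewrite /F pickleK.
Qed.

Theorem theorem2p2 (R : realType) (m n : nat) (m_gt0 : (0 < m)%N)
    (n_gt0 : (0 < n)%N) (mu : {measure set (borel_mx R m n) -> \bar R}) :
  (forall v : \bar R,
     locally_ae contracting mu ->
     {ae mu, forall X : borel_mx R m n, dioph_exp X 0 = v} ->
     forall theta : 'cV[R]_m,
       {ae mu, forall X : borel_mx R m n, (dioph_exp X theta <= v)%E})
  /\
  (forall v : \bar R,
     locally_ae strongly_contracting mu ->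
     {ae mu, forall X : borel_mx R m n, dioph_mexp X 0 = v} ->
     forall theta : 'cV[R]_m,
       {ae mu, forall X : borel_mx R m n, (dioph_mexp X theta <= v)%E}).
Proof.
split=> v.
  apply: (@exponent_transference _ _ _ contracting approximable) => //.
  - by move=> X theta w w'; exact: approximable_le.
  - by move=> X; exact: approximable0.
  - by move=> nu theta w1 w2 nu_con w10 w12; exact: contracting_transference.
apply: (@exponent_transference _ _ _ strongly_contracting mult_approximable) => //.
- by move=> X theta w w'; exact: mult_approximable_le.
- by move=> X; exact: mult_approximable0.
- move=> nu theta w1 w2 nu_con w10 w12.
  exact: strongly_contracting_transference.
Qed.
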